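(* Let $(X,\mathrm{d}\mu)$ be a $\sigma$-finite measure space, let $\mathcal{Y}_1,\dots,\mathcal{Y}_d$ be quasi-normed spaces and let $0<p_j<\infty$ for $1\le j\le d$. Suppose the maps $T_j:\mathcal{Y}_j\to\mathcal{M}(X)$ are homogeneous of degree $1$, that is, $T_j(\lambda f_j)=\lambda T_jf_j$ for all $f_j\in\mathcal{Y}_j$ and all scalars $\lambda$. Assume that for all $j$ the family of functions $\{|T_jf_j|:f_j\in\mathcal{Y}_j\}$ saturates $X$. Let $\theta_j>0$ satisfy $\sum_{j=1}^d\theta_j=1$, and suppose that $$\int_X\prod_{j=1}^d\Big(\sum_{k=1}^N|T_jf_{jk}(x)|^{p_j}\Big)^{\theta_j}\mathrm{d}\mu(x)\le A\prod_{j=1}^d\Big(\sum_{k=1}^N\|f_{jk}\|_{\mathcal{Y}_j}^{p_j}\Big)^{\theta_j}$$ for all $N\ge1$ and all $f_{jk}\in\mathcal{Y}_j$ ($1\le j\le d$, $1\le k\le N$), with $A$ independent of $N$. Then there exist nonnegative measurable functions $\phi_1,\dots,\phi_d$ on $X$ such that $$\prod_{j=1}^d\phi_j(x)^{\theta_j}\ge1\quad\text{for a.e. }x\in X,$$ and such that for each $j$, $$\left(\int_X|T_jf_j(x)|^{p_j}\phi_j(x)\,\mathrm{d}\mu(x)\right)^{1/p_j}\le A^{1/p_j}\|f_j\|_{\mathcal{Y}_j}\quad\text{for all } f_j\in\mathcal{Y}_j.$$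
   Context: $\mathcal{M}(X)$ is the class of measurable functions on $X$. A quasi-normed space is defined like a normed space but with the triangle inequality replaced by $\|x+y\|\le K(\|x\|+\|y\|)$ for some $K\ge1$. A family $\mathcal{G}$ of nonnegative measurable functions on $X$ saturates $X$ if for every measurable $E\subseteq X$ with $\mu(E)>0$ there exist a measurable $E'\subseteq E$ with $\mu(E')>0$ and a $g\in\mathcal{G}$ such that $g>0$ on $E'$. *)

(* Defs.v *)
From HB Require Import structures.
From mathcomp Require Export all_boot all_order all_algebra.
From mathcomp Require Export complex.
From mathcomp Require Export all_classical all_reals all_analysis.

Set Implicit Arguments.
Unset Strict Implicit.
Unset Printing Implicit Defensive.
Export Order.TTheory GRing.Theory Num.Theory.
Export numFieldNormedType.Exports.

Local Open Scope classical_set_scope.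
Local Open Scope ring_scope.

(* The two possible scalar fields are treated together, so that both real and
   complex quasi-normed spaces (and real- and complex-valued functions) are
   covered by a single statement. *)
Variant scalar_kind : Type := RealScalars | ComplexScalars.

Definition scalar (R : realType) (k : scalar_kind) : numFieldType :=
  match k with
  | RealScalars => R
  | ComplexScalars => R[i]
  end.

(* The norm of R[i] in the library takes its values in R[i], whence the use of
   the R-valued complex modulus here. *)
Definition modulus (R : realType) (k : scalar_kind) : scalar R k -> R :=
  match k return scalar R k -> R with
  | RealScalars => fun a : R => `|a|
  | ComplexScalars => fun a : R[i] => ComplexField.Normc.normc a
  end.

Definition scalar_measurable (R : realType) (k : scalar_kind)
    (dd : measure_display) (X : measurableType dd) :
    (X -> scalar R k) -> Prop :=
  match k return (X -> scalar R k) -> Prop with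
  | RealScalars => fun g : X -> R => measurable_fun [set: X] g
  | ComplexScalars => fun g : X -> R[i] =>
      measurable_fun [set: X] (fun x => complex.Re (g x)) /\
      measurable_fun [set: X] (fun x => complex.Im (g x))
  end.

Record quasiNormedSpace (R : realType) (k : scalar_kind) := QuasiNormedSpace {
  qcarrier :> lmodType (scalar R k) ;
  qnorm : qcarrier -> R ;
  qnorm_ge0 : forall u, 0 <= qnorm u ;
  qnorm_eq0 : forall u, qnorm u = 0 -> u = 0 ;
  qnormZ : forall a u, qnorm (a *: u) = modulus a * qnorm u ;
  qnorm_triangle : exists K : R, 1 <= K /\
    forall u v, qnorm (u + v) <= K * (qnorm u + qnorm v)
}.

Definition saturates (R : realType) (dd : measure_display)
    (X : measurableType dd) (mu : {measure set X -> \bar R})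
    (G : set (X -> R)) : Prop :=
  forall E : set X, measurable E -> (0 < mu E)%E ->
    exists E' : set X, exists g : X -> R,
      [/\ measurable E', E' `<=` E, (0 < mu E')%E, G g &
          forall x, E' x -> 0 < g x].

(* Main.v *)
Require Import Defs.
From mathcomp Require Import measurable_realfun ring lra.

(** The maps [T j] enter only through the families [G j] of all finite sums
    [sum_k |T_j f_k|^p_j] with [sum_k ||f_k||^p_j <= 1].  Homogeneity makes each
    [G j] a convex set of nonnegative functions ([power_sums_convex]), and the
    hypothesis says that the integral of the weighted geometric mean
    [gmean theta g = prod_j g_j ^ theta_j] is at most [A] whenever every [g_j]
    lies in [G j].  What is wanted is weights [phi_j] of geometric mean at least
    [1] with [int h phi_j <= A] for all [h] in [G j] ([multilinear_duality]).

    If the functional [F(a) = int gmean theta a] attained its maximum over the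
    product of the [G j] at a strictly positive tuple [a], the weights
    [phi_j = gmean theta a / a_j] would do.  Their geometric mean is [1], and
    letting [a_j] move towards [h] in [G j] shows that
    [int h phi_j <= int a_j phi_j = F(a) <= A].  Maximisers need not exist, since
    [F] is not upper semicontinuous, and they need not be positive.  Both
    obstacles disappear if one gives up a little.  Mixing a small multiple of a
    fixed tuple [e], bounded below on a set [E], into all competitors keeps them
    away from [0] on [E], and a near-maximiser then satisfies the variational
    inequality up to a small error, provided that [h] is replaced by the truncation
    [h / (1 + h/n)] ([approximate_weights]).  Saturation and sigma-finiteness
    supply tuples [e_n] and sets [E_n] that increase to almost all of the space
    ([exhausting_sets]).

    It remains to pass to the limit.  The tuples [phi] that are admissible at stage
    [n] form a decreasing sequence of convex sets.  Minimising the strictly convex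
    functional [int sum_j 1/(1 + phi_j)] over these sets, for a finite measure,
    yields a sequence that converges almost everywhere in [[0, +oo]]
    ([convex_sets_ae_cvg]).  Fatou's lemma carries the bounds
    [int h phi_j <= A] to the limit; together with saturation they also exclude
    the value [+oo]. *)

Local Open Scope classical_set_scope.
Local Open Scope ring_scope.

Set Implicit Arguments.
Unset Strict Implicit.
Unset Printing Implicit Defensive.

(** * Real powers *)

Section PowerInequalities.
Context {R : realType}.
Implicit Types q s y c t : R.

(** Concavity of [z ^ q]: the graph lies below its tangent at [1].  In
    exponential form this is the convexity of [exp], obtained from its tangent at [0]. *)
Lemma powR_le_affine q z : 0 < q -> q <= 1 -> 0 < z ->
  z `^ q <= q * z + (1 - q).
Proof.
move=> q0 q1 z0; have z0' : z != 0 by rewrite gt_eqF.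
rewrite /powR (negbTE z0').
set l := ln z; have zE : z = expR l by rewrite /l lnK// posrE.
rewrite zE.
have E0 := expR_gt0 (q * l).
have H1 : expR (q * l) * (1 + (1 - q) * l) <= expR l.
  rewrite [leRHS](_ : _ = expR (q * l) * expR ((1 - q) * l)).
    by rewrite ler_pM2l// expR_ge1Dx.
  by rewrite -expRD; congr expR; ring.
have H2 : expR (q * l) * (1 + - q * l) <= 1.
  rewrite [leRHS](_ : _ = expR (q * l) * expR (- q * l)).
    by rewrite ler_pM2l// expR_ge1Dx.
  by rewrite -expRD (_ : _ + _ = 0) ?expR0//; ring.
nra.
Qed.

Lemma powR_div_anti q y c : q <= 1 -> 0 < y -> y <= c ->
  c `^ q / c <= y `^ q / y.
Proof.
move=> q1 y0 yc; have c0 : 0 < c by exact: lt_le_trans yc.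
rewrite ler_pdivrMr// mulrAC ler_pdivlMr//.
have -> : y `^ q = c `^ q * (y / c) `^ q.
  by rewrite -powRM ?ltW// ?divr_gt0// mulrC divfK// gt_eqF.
rewrite -mulrA ler_pM2l ?powR_gt0//.
rewrite -ler_pdivrMr//; apply: ger1_powR => //.
by rewrite divr_gt0//= ler_pdivrMr// mul1r.
Qed.

End PowerInequalities.

(** * Weighted geometric means *)

Section GeometricMean.
Context {R : realType} {I : finType}.
Variable theta : I -> R.
Hypothesis theta_gt0 : forall i, 0 < theta i.
Hypothesis theta_sum : \sum_i theta i = 1.
Implicit Types a b : I -> R.

Definition gmean a : R := \prod_i a i `^ theta i.

Definition subst (j : I) (y : R) a : I -> R :=
  fun i => if i == j then y else a i.

Lemma theta_le1 i : theta i <= 1.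
Proof.
rewrite -theta_sum (bigD1 i)//= lerDl.
by apply: sumr_ge0 => k _; exact: ltW.
Qed.

Lemma gmean_ge0 a : 0 <= gmean a.
Proof. by apply: prodr_ge0 => i _; exact: powR_ge0. Qed.

Lemma gmean_gt0 a : (forall i, 0 < a i) -> 0 < gmean a.
Proof. by move=> a0; apply: prodr_gt0 => i _; exact: powR_gt0. Qed.

Lemma le_gmean a b : (forall i, 0 <= a i) -> (forall i, a i <= b i) ->
  gmean a <= gmean b.
Proof.
move=> a0 ab; apply: ler_prod => i _; rewrite powR_ge0/=.
have bi := le_trans (a0 i) (ab i).
by apply: ge0_ler_powR; rewrite ?nnegrE// ltW.
Qed.

Lemma gmean_mul a b : (forall i, 0 <= a i) -> (forall i, 0 <= b i) ->
  gmean (fun i => a i * b i) = gmean a * gmean b.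
Proof.
move=> a0 b0; rewrite /gmean -big_split; apply: eq_bigr => i _.
by rewrite powRM.
Qed.

Lemma gmean_cst c : 0 <= c -> gmean (fun=> c) = c.
Proof.
move=> c0; have [->|cN0] := eqVneq c 0.
  rewrite /gmean; have [i _|noi] := pickP (fun _ : I => true).
    by rewrite (bigD1 i)//= powR0 ?mul0r// gt_eqF.
  have /eqP := @oner_neq0 R; case; rewrite -theta_sum big_pred0//.
rewrite /gmean -[RHS]powRr1// -theta_sum.
by apply/esym/(big_morph (powR c)) => [r s|]; rewrite ?powRr0// powRD// cN0 implybT.
Qed.

Lemma gmean_subst j y a :
  gmean (subst j y a) = y `^ theta j * \prod_(i | i != j) a i `^ theta i.
Proof.
rewrite /gmean (bigD1 j)//= /subst eqxx; congr (_ * _).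
by apply: eq_bigr => i /negbTE ->.
Qed.

Lemma subst_id j a : subst j (a j) a = a.
Proof. by apply/funext => i; rewrite /subst; case: eqP => [->|]. Qed.

(** Concavity of [gmean] in its [j]-th entry: the value at [a j] lies below the
    tangent taken at the point [y].  It is taken at the perturbed point because the
    quantity [gmean (subst j y a) / y] is the one that the variation controls. *)
Lemma gmean_le_tangent j y a : (forall i, 0 < a i) -> 0 < y ->
  gmean a <= theta j * (gmean (subst j y a) * (a j / y))
             + (1 - theta j) * gmean (subst j y a).
Proof.
move=> a0 y0; rewrite -{1}(subst_id j a) !gmean_subst.
set W := \prod_(_ | _) _.
have W0 : 0 <= W by apply: prodr_ge0 => i _; exact: powR_ge0.
have -> : a j `^ theta j = y `^ theta j * (a j / y) `^ theta j.
  by rewrite -powRM ?ltW// ?divr_gt0// mulrC divfK// gt_eqF.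
have := powR_le_affine (theta_gt0 j) (theta_le1 j) (divr_gt0 (a0 j) y0).
set z := (_ / y); set p := z `^ _; set c := y `^ _ => H.
have c0 : 0 <= c by exact: powR_ge0.
have := ler_wpM2l (mulr_ge0 c0 W0) H; nra.
Qed.

(** The partial derivative of [gmean] in the [j]-th entry is proportional to
    this quotient, which decreases because [theta j <= 1]. *)
Lemma gmean_subst_div_anti j y c a : (forall i, 0 < a i) -> 0 < y -> y <= c ->
  gmean (subst j c a) / c <= gmean (subst j y a) / y.
Proof.
move=> a0 y0 yc; rewrite !gmean_subst.
set W := \prod_(_ | _) _.
have W0 : 0 <= W by apply: prodr_ge0 => i _; exact: powR_ge0.
by rewrite mulrAC [leRHS]mulrAC; apply: ler_wpM2r => //;
  exact: powR_div_anti (theta_le1 j) _ _.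
Qed.

End GeometricMean.

(** * Nonnegative measurable functions *)

Section NonnegativeFunctions.
Context {R : realType} {dd : measure_display} {X : measurableType dd}.
Implicit Types f g : X -> R.

Definition nnmeasurable f : Prop :=
  measurable_fun [set: X] f /\ forall x, 0 <= f x.

Lemma nnmeasurable_cst c : 0 <= c -> nnmeasurable (fun=> c).
Proof. by move=> c0; split. Qed.

Lemma nnmeasurable_add f g : nnmeasurable f -> nnmeasurable g ->
  nnmeasurable (fun x => f x + g x).
Proof.
move=> [mf f0] [mg g0]; split; first exact: measurable_funD.
by move=> x; rewrite addr_ge0.
Qed.

Lemma nnmeasurable_mul f g : nnmeasurable f -> nnmeasurable g ->
  nnmeasurable (fun x => f x * g x).
Proof.
move=> [mf f0] [mg g0]; split; first exact: measurable_funM.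
by move=> x; rewrite mulr_ge0.
Qed.

Lemma nnmeasurable_powR q f : nnmeasurable f -> nnmeasurable (fun x => f x `^ q).
Proof.
move=> [mf f0]; split; last by move=> x; exact: powR_ge0.
exact: measurableT_comp (measurable_powR _) mf.
Qed.

Lemma nnmeasurable_inv f : nnmeasurable f -> nnmeasurable (fun x => (f x)^-1).
Proof.
move=> f0; suff -> : (fun x => (f x)^-1) = (fun x => f x `^ (-1)).
  exact: nnmeasurable_powR.
by apply/funext => x; rewrite powR_inv1//; exact: f0.2.
Qed.

Lemma nnmeasurable_div f g : nnmeasurable f -> nnmeasurable g ->
  nnmeasurable (fun x => f x / g x).
Proof. by move=> f0 g0; apply: nnmeasurable_mul => //; exact: nnmeasurable_inv. Qed.

Lemma nnmeasurable_indic (E : set X) : measurable E ->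
  nnmeasurable (\1_E : X -> R).
Proof. by move=> mE; split=> //; exact: measurable_indic. Qed.

Lemma nnmeasurable_sum (J : Type) (s : seq J) (f : J -> X -> R) :
  (forall i, nnmeasurable (f i)) -> nnmeasurable (fun x => \sum_(i <- s) f i x).
Proof.
move=> f0; split; first by apply: measurable_sum => i; exact: (f0 i).1.
by move=> x; apply: sumr_ge0 => i _; exact: (f0 i).2.
Qed.

Lemma nnmeasurable_gmean (I : finType) (theta : I -> R) (a : I -> X -> R) :
  (forall i, nnmeasurable (a i)) -> nnmeasurable (fun x => gmean theta (a^~ x)).
Proof.
move=> a0; split; last by move=> x; exact: gmean_ge0.
by apply: measurable_prod => i _; exact: (nnmeasurable_powR _ (a0 i)).1.
Qed.

Lemma nnmeasurable_EFin (D : set X) f : measurable D -> nnmeasurable f ->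
  measurable_fun D (EFin \o f).
Proof.
move=> mD [mf _]; apply/measurable_EFinP.
exact: measurable_funS mf.
Qed.

Variable mu : {measure set X -> \bar R}.

Lemma nnintegral_ge0 (D : set X) f : nnmeasurable f ->
  (0 <= \int[mu]_(x in D) (f x)%:E)%E.
Proof. by move=> f0; apply: integral_ge0 => x _; rewrite lee_fin; exact: f0.2. Qed.

Lemma le_nnintegral (D : set X) f g : measurable D ->
  nnmeasurable f -> nnmeasurable g -> (forall x, D x -> f x <= g x) ->
  (\int[mu]_(x in D) (f x)%:E <= \int[mu]_(x in D) (g x)%:E)%E.
Proof.
move=> mD f0 g0 fg; apply: ge0_le_integral => //.
- by move=> x _; rewrite lee_fin; exact: f0.2.
- exact: nnmeasurable_EFin.
- exact: nnmeasurable_EFin.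
Qed.

Lemma nnintegral_lincomb (D : set X) f g s t : measurable D ->
  0 <= s -> 0 <= t -> nnmeasurable f -> nnmeasurable g ->
  (\int[mu]_(x in D) (s * f x + t * g x)%:E =
   s%:E * \int[mu]_(x in D) (f x)%:E + t%:E * \int[mu]_(x in D) (g x)%:E)%E.
Proof.
move=> mD s0 t0 f0 g0.
under eq_integral do rewrite EFinD !EFinM.
have sf : nnmeasurable (fun x => s * f x).
  by apply: nnmeasurable_mul => //; exact: nnmeasurable_cst.
have tg : nnmeasurable (fun x => t * g x).
  by apply: nnmeasurable_mul => //; exact: nnmeasurable_cst.
rewrite ge0_integralD//.
- by rewrite !ge0_integralZl_EFin// => x; rewrite ?lee_fin ?f0.2 ?g0.2//;
    exact: nnmeasurable_EFin.
- by move=> x _; rewrite -EFinM lee_fin sf.2.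
- exact: (nnmeasurable_EFin mD sf).
- by move=> x _; rewrite -EFinM lee_fin tg.2.
- exact: (nnmeasurable_EFin mD tg).
Qed.

Lemma nnintegralZ (D : set X) f s : measurable D -> 0 <= s -> nnmeasurable f ->
  (\int[mu]_(x in D) (s * f x)%:E = s%:E * \int[mu]_(x in D) (f x)%:E)%E.
Proof.
move=> mD s0 f0; under eq_integral do rewrite EFinM.
by rewrite ge0_integralZl_EFin// => x; rewrite ?lee_fin ?f0.2//;
    exact: nnmeasurable_EFin.
Qed.

End NonnegativeFunctions.

(** * Variation of the geometric mean at a near-maximiser *)

Section ApproximateWeights.
Context {R : realType} {dd : measure_display} {X : measurableType dd}.
Variables (mu : {measure set X -> \bar R}) (I : finType) (theta : I -> R).
Hypothesis theta_gt0 : forall i, 0 < theta i.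
Hypothesis theta_sum : \sum_i theta i = 1.
Variables (G : I -> set (X -> R)) (A : R).
Hypothesis G_nn : forall j g, G j g -> nnmeasurable g.
Hypothesis G_convex : forall j g h t, 0 <= t <= 1 -> G j g -> G j h ->
  G j (fun x => (1 - t) * g x + t * h x).
Hypothesis G_bound : forall g : I -> X -> R, (forall j, G j (g j)) ->
  (\int[mu]_x (gmean theta (g^~ x))%:E <= A%:E)%E.

Lemma theta_lbound : exists2 t, 0 < t & forall j, t <= theta j.
Proof.
exists (\prod_j theta j); first by apply: prodr_gt0.
move=> j; rewrite (bigD1 j)//=; apply: ler_piMr; first exact: ltW.
by apply: prodr_ile1 => i _; rewrite (theta_le1 theta_gt0)// ltW/=.
Qed.

Definition substf (j : I) (y : X -> R) (a : I -> X -> R) : I -> X -> R :=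
  fun i x => subst j (y x) (a^~ x) i.

Lemma substfE j y a i : substf j y a i = if i == j then y else a i.
Proof. by apply/funext => x; rewrite /substf /subst; case: eqP. Qed.

(** The quantitative first-order condition at a tuple [a] that maximises up
    to [eta].  Let [F] and [F'] be the integrals of [gmean] before and after [a j] is
    moved to [y = (1 - t) a_j + t b], and let [P] and [Q] be the integrals of the
    perturbed mean times [a_j / y] and [b / y].  Then [F' = (1 - t) P + t Q],
    while concavity gives [F <= theta_j P + (1 - theta_j) F'], so that
    [F' <= F + eta] forces [Q <= P + eta / (theta_j t)].  Finally [P <= F / (1 - t)]
    because [y >= (1 - t) a_j]. *)
Lemma first_variation (E : set X) (a : I -> X -> R) (b : X -> R) (j : I) (s t eta : R) :
  measurable E -> 0 < t -> t < 1 -> 0 < s ->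
  (forall i, nnmeasurable (a i)) -> nnmeasurable b ->
  (forall i x, E x -> s <= a i x) ->
  (\int[mu]_(x in E) (gmean theta (a^~ x))%:E <= A%:E)%E ->
  let y x := (1 - t) * a j x + t * b x in
  (\int[mu]_(x in E) (gmean theta (substf j y a ^~ x))%:E
    <= \int[mu]_(x in E) (gmean theta (a^~ x))%:E + eta%:E)%E ->
  (\int[mu]_(x in E) (gmean theta (substf j y a ^~ x) * (b x / y x))%:E
     <= (A / (1 - t) + eta / (theta j * t))%:E)%E.
Proof.
move=> mE t0 t1 s0 a0 b0 sa FA y Fy.
have y0 : nnmeasurable y.
  by apply: nnmeasurable_add; apply: nnmeasurable_mul => //;
     apply: nnmeasurable_cst; lra.
have sub0 i : nnmeasurable (substf j y a i).
  by rewrite substfE; case: ifP.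
have y_gt0 x : E x -> 0 < y x.
  by move=> Ex; rewrite /y; have := sa j x Ex; have := b0.2 x; nra.
have a_gt0 i x : E x -> 0 < a i x by move=> /(sa i); exact: lt_le_trans.
set c := fun x => gmean theta (substf j y a ^~ x).
have c0 : nnmeasurable c by exact: nnmeasurable_gmean.
have pa0 : nnmeasurable (fun x => c x * (a j x / y x)).
  by apply: nnmeasurable_mul => //; apply: nnmeasurable_div.
have pb0 : nnmeasurable (fun x => c x * (b x / y x)).
  by apply: nnmeasurable_mul => //; apply: nnmeasurable_div.
set F := (\int[mu]_(x in E) (gmean theta (a^~ x))%:E)%E in FA Fy *.
set F' := (\int[mu]_(x in E) (c x)%:E)%E in Fy.
set P := (\int[mu]_(x in E) (c x * (a j x / y x))%:E)%E.
set Q := (\int[mu]_(x in E) (c x * (b x / y x))%:E)%E.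
have F0 : (0 <= F)%E by apply: nnintegral_ge0; exact: nnmeasurable_gmean.
have F'0 : (0 <= F')%E by exact: nnintegral_ge0.
have P0 : (0 <= P)%E by exact: nnintegral_ge0.
have Q0 : (0 <= Q)%E by exact: nnintegral_ge0.
have t0' := ltW t0; have t1' : 0 <= 1 - t by lra.
have th0 := theta_gt0 j; have th1 := theta_le1 theta_gt0 theta_sum j.
have F'E : F' = ((1 - t)%:E * P + t%:E * Q)%E.
  rewrite -nnintegral_lincomb//; apply: eq_integral => x /set_mem Ex; congr _%:E.
  rewrite mulrCA [t * _]mulrCA -mulrDr !mulrA -mulrDl.
  by rewrite -/(y x) divff ?mulr1// gt_eqF// y_gt0.
have FPF' : (F <= (theta j)%:E * P + (1 - theta j)%:E * F')%E.
  rewrite -nnintegral_lincomb//; [|exact: ltW|by rewrite subr_ge0].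
  apply: le_nnintegral => //; first exact: nnmeasurable_gmean.
    by apply: nnmeasurable_add; apply: nnmeasurable_mul => //;
      apply: nnmeasurable_cst; lra.
  move=> x Ex; apply: gmean_le_tangent => //; last exact: y_gt0.
  by move=> i; exact: a_gt0.
have PF : (P <= (1 - t)^-1%:E * F)%E.
  rewrite -nnintegralZ//; last 2 first.
    by rewrite invr_ge0.
    exact: nnmeasurable_gmean.
  apply: le_nnintegral => //.
    apply: nnmeasurable_mul; last exact: nnmeasurable_gmean.
    by apply: nnmeasurable_cst; rewrite invr_ge0.
  move=> x Ex; have yx := y_gt0 x Ex; have ax := a_gt0 j x Ex.
  have zx : 0 < (1 - t) * a j x by rewrite mulr_gt0//; lra.
  have zy : (1 - t) * a j x <= y x.
    by rewrite lerDl mulr_ge0// b0.2.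
  have := gmean_subst_div_anti theta_gt0 theta_sum j (a := a ^~ x)
    (fun i => a_gt0 i x Ex) zx zy.
  rewrite -/(c x) => cy.
  have le_a : gmean theta (subst j ((1 - t) * a j x) (a ^~ x)) <= gmean theta (a ^~ x).
    apply: le_gmean => // i; rewrite /subst.
      by case: eqP => // _; [exact: ltW|exact: (a0 i).2].
    by case: eqP => // ->; rewrite ler_piMl// ?ltW//; lra.
  have -> : c x * (a j x / y x) = c x / y x * a j x by rewrite mulrA mulrAC.
  rewrite -ler_pdivlMr//; apply: (le_trans cy).
  have -> : (1 - t)^-1 * gmean theta (a ^~ x) / a j x =
            gmean theta (a ^~ x) / ((1 - t) * a j x).
    by rewrite invfM mulrCA mulrA.
  by apply: ler_wpM2r => //; rewrite invr_ge0 ltW.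
have Ffin : F \is a fin_num.
  by rewrite ge0_fin_numE// (le_lt_trans FA)// ltry.
have Pfin : P \is a fin_num.
  rewrite ge0_fin_numE// (le_lt_trans PF)//.
  by rewrite -(fineK Ffin) -EFinM ltry.
have F'fin : F' \is a fin_num.
  by rewrite ge0_fin_numE// (le_lt_trans Fy)// -(fineK Ffin) -EFinD ltry.
have Qfin : Q \is a fin_num.
  rewrite ge0_fin_numE// ltNge leye_eq; apply/negP => /eqP Qoo.
  move: F'fin; rewrite F'E Qoo -(fineK Pfin) -EFinM gt0_muley ?lte_fin//.
move: FA Fy F'E FPF' PF; rewrite -/Q -/F -/F'.
rewrite -(fineK Ffin) -(fineK F'fin) -(fineK Pfin) -(fineK Qfin).
move: (fine F) (fine F') (fine P) (fine Q) => f f' p q.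
rewrite -!EFinM -!EFinD !lee_fin => fA f'f [f'E] fpf' pf.
have pA : p <= A / (1 - t).
  by apply: (le_trans pf); rewrite mulrC ler_wpM2r// invr_ge0.
have t'q : theta j * t * q <= theta j * t * p + eta by nra.
have tt0 : 0 < theta j * t by rewrite mulr_gt0.
have : q <= p + eta / (theta j * t).
  rewrite -(ler_pM2l tt0) mulrDr [_ * (_ / _)]mulrC divfK// gt_eqF//.
lra.
Qed.

(** The weights are [gmean a / a_j] on [E] and [0] elsewhere, where [a]
    maximises the integral over [E] up to [eta] among the tuples
    [(1 - eps) g + eps e] with [g j] in [G j].  Moving [a_j] towards
    [(1 - eps) h + eps e_j] stays within these tuples, and [first_variation] bounds
    the integral of [h] against the perturbed weight.  As [a_j >= eps delta] on [E],
    a step [t <= eps delta / (n + 1)] increases [a_j] to at most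
    [a_j (1 + h/(n + 1))], which is the price for a weight that does not depend on [h]. *)
Lemma approximate_weights (E : set X) (e : I -> X -> R) (delta B : R) (n : nat) :
  measurable E -> (forall j, G j (e j)) -> 0 < delta ->
  (forall j x, E x -> delta <= e j x) -> A < B ->
  exists phi : I -> X -> R,
    [/\ forall j, nnmeasurable (phi j),
        forall x, E x -> gmean theta (phi^~ x) = 1 &
        forall j h, G j h ->
          (\int[mu]_x (h x / (1 + h x / n.+1%:R) * phi j x)%:E <= B%:E)%E].
Proof.
move=> mE Ge delta0 edelta AB.
have A0 : 0 <= A.
  rewrite -lee_fin; apply: le_trans (G_bound Ge).
  by apply: nnintegral_ge0; apply: nnmeasurable_gmean => j; exact: G_nn (Ge j).
have B0 : 0 < B by exact: le_lt_trans AB.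
(* This [eps] makes [(1 - eps)^2 B >= (A + B)/2], which leaves [(B - A)/2]
   for the error due to [eta]. *)
pose eps := (B - A) / (4 * B).
have epsE : eps * (4 * B) = B - A by rewrite /eps divfK// gt_eqF// mulr_gt0.
have eps0 : 0 < eps by rewrite divr_gt0 ?subr_gt0// mulr_gt0.
have eps1 : eps <= 1 / 4 by nra.
pose s := eps * delta.
have s0 : 0 < s by rewrite mulr_gt0.
pose t := Num.min eps (s / n.+1%:R).
have t0 : 0 < t by rewrite lt_min eps0/= divr_gt0.
have teps : t <= eps by rewrite ge_min lexx.
have ts : t * n.+1%:R <= s by rewrite -ler_pdivlMr// ge_min lexx orbT.
have [theta0 theta0_gt0 theta0_le] := theta_lbound.
pose eta := theta0 * t * ((B - A) / 2).
have eta0 : 0 < eta by rewrite !mulr_gt0// subr_gt0.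
pose mix (g : I -> X -> R) j x := (1 - eps) * g j x + eps * e j x.
have eps01 : 0 <= eps <= 1 by apply/andP; split; lra.
have G_mix g : (forall j, G j (g j)) -> forall j, G j (mix g j).
  by move=> Gg j; apply: G_convex.
pose F a := (\int[mu]_(x in E) (gmean theta (a ^~ x))%:E)%E.
have F_bound a : (forall j, G j (a j)) -> (F a <= A%:E)%E.
  move=> Ga; apply: le_trans (G_bound Ga).
  have a0 : nnmeasurable (fun x => gmean theta (a ^~ x)).
    by apply: nnmeasurable_gmean => j; exact: G_nn (Ga j).
  apply: ge0_subset_integral => //; first exact: nnmeasurable_EFin.
  by move=> x _; rewrite lee_fin a0.2.
have F_ge0 a : (forall j, G j (a j)) -> (0 <= F a)%E.
  move=> Ga; apply: nnintegral_ge0.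
  by apply: nnmeasurable_gmean => j; exact: G_nn (Ga j).
pose S := [set F (mix g) | g in [set g | forall j, G j (g j)]].
have Ssup : ereal_sup S \is a fin_num.
  have S0 : (0 <= ereal_sup S)%E.
    by apply: le_trans (F_ge0 _ (G_mix e Ge)) _; apply: ereal_sup_ubound; exists e.
  rewrite ge0_fin_numE//; apply: le_lt_trans (ltry A).
  by apply: ge_ereal_sup => _ [g Gg <-]; exact: F_bound (G_mix _ Gg).
have [_ [g Gg <-] Fg] := ub_ereal_sup_adherent eta0 Ssup.
pose a := mix g.
have Ga := G_mix _ Gg.
have a0 i : nnmeasurable (a i) by exact: G_nn (Ga i).
have sa i x : E x -> s <= a i x.
  move=> Ex; rewrite /a /mix; have := edelta i x Ex.
  have := (G_nn (Gg i)).2 x.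
  rewrite -[(_ <= e i x)](ler_pM2l eps0) -/s; nra.
pose Gamma x := gmean theta (a ^~ x).
have Gamma0 : nnmeasurable Gamma by exact: nnmeasurable_gmean.
exists (fun j x => Gamma x / a j x * \1_E x); split.
- move=> j; apply: nnmeasurable_mul; last exact: nnmeasurable_indic.
  exact: nnmeasurable_div.
- move=> x Ex; rewrite indicE mem_set//=.
  have agt0 i : 0 < a i x by exact: lt_le_trans (sa i x Ex).
  under [X in gmean _ X]eq_fun do rewrite mulr1.
  have G0 : 0 < Gamma x by exact: gmean_gt0.
  rewrite gmean_mul; [|by move=> _; exact: ltW|by move=> i; rewrite invr_ge0 ltW].
  rewrite gmean_cst// ?ltW//.
  rewrite /Gamma -gmean_mul; [|by move=> i; rewrite ltW|by move=> i; rewrite invr_ge0 ltW].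
  under [X in gmean _ X]eq_fun do rewrite divff ?gt_eqF//.
  exact: gmean_cst.
move=> j h Gh.
have h0 := G_nn Gh.
pose b x := (1 - eps) * h x + eps * e j x.
have b0 : nnmeasurable b by apply: (G_nn (j := j)); exact: G_convex.
have t1 : t < 1 by lra.
pose y x := (1 - t) * a j x + t * b x.
pose c := substf j y a.
have variation : (F c <= F a + eta%:E)%E ->
    (\int[mu]_(x in E) (gmean theta (c ^~ x) * (b x / y x))%:E
     <= (A / (1 - t) + eta / (theta j * t))%:E)%E.
  exact: first_variation mE t0 t1 s0 a0 b0 sa (F_bound _ Ga).
pose g' := substf j (fun x => (1 - t) * g j x + t * h x) g.
have mixc : c = mix g'.
  apply/funext => i; rewrite /c substfE /mix /g' substfE; case: eqP => // ->.
  by apply/funext => x; rewrite /y /a /b /mix; ring.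
have Gg' i : G i (g' i).
  rewrite /g' substfE; case: eqP => // ->.
  by apply: G_convex => //; apply/andP; split; lra.
have y0 : nnmeasurable y.
  by apply: nnmeasurable_add; apply: nnmeasurable_mul => //; apply: nnmeasurable_cst; lra.
have y_gt0 x : E x -> 0 < y x.
  by move=> Ex; rewrite /y; have := sa j x Ex; have := b0.2 x; nra.
have c0 : nnmeasurable (fun x => gmean theta (c ^~ x)).
  by apply: nnmeasurable_gmean => i; rewrite mixc; exact: G_nn (G_mix _ Gg' i).
have /variation Q_le : (F c <= F a + eta%:E)%E.
  rewrite -leeBlDr//; apply: le_trans (ltW Fg).
  apply: leeB => //; apply: ereal_sup_ubound; rewrite mixc.
  by exists g'.
have phi0 : nnmeasurable (fun x => h x / (1 + h x / n.+1%:R) * (Gamma x / a j x)).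
  apply: nnmeasurable_mul; last exact: nnmeasurable_div.
  apply: nnmeasurable_div => //; apply: nnmeasurable_add; first exact: nnmeasurable_cst.
  by apply: nnmeasurable_div => //; exact: nnmeasurable_cst.
have -> : (\int[mu]_x (h x / (1 + h x / n.+1%:R) * (Gamma x / a j x * \1_E x))%:E =
  \int[mu]_(x in E) (h x / (1 + h x / n.+1%:R) * (Gamma x / a j x))%:E)%E.
  rewrite [RHS]integral_mkcond; apply: eq_integral => x _.
  rewrite patchE indicE; case: ifP => _; last by rewrite !mulr0.
  by rewrite mulr1.
have eps1' : 0 < 1 - eps by lra.
have : ((1 - eps)%:E * \int[mu]_(x in E) (h x / (1 + h x / n.+1%:R) * (Gamma x / a j x))%:E
   <= \int[mu]_(x in E) (gmean theta (c ^~ x) * (b x / y x))%:E)%E.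
  rewrite -nnintegralZ//; last exact: ltW.
  apply: le_nnintegral => //.
  - by apply: nnmeasurable_mul => //; apply: nnmeasurable_cst; exact: ltW.
  - by apply: nnmeasurable_mul => //; exact: nnmeasurable_div.
  move=> x Ex.
  have ax : 0 < a j x by exact: lt_le_trans (sa j x Ex).
  have hx := h0.2 x.
  have N0 : 0 < n.+1%:R :> R by [].
  set u := h x / n.+1%:R.
  have u0 : 0 <= u by rewrite divr_ge0.
  have uN : u * n.+1%:R = h x by rewrite divfK// gt_eqF.
  set z := a j x + t * h x.
  have yz : y x <= z.
    rewrite /y /z /b; have := (G_nn (Gg j)).2 x => gx.
    have ge0 : 0 <= (1 - eps) * g j x by rewrite mulr_ge0// ltW.
    have ae : eps * e j x <= a j x by rewrite /a /mix lerDr.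
    have th := mulr_ge0 (ltW t0) (mulr_ge0 (ltW eps0) hx).
    have := ler_wpM2l (ltW t0) ae; lra.
  have z_le : z <= a j x * (1 + u).
    rewrite /z mulrDr mulr1 lerD2l -uN mulrCA [leRHS]mulrC.
    by apply: ler_wpM2l => //; exact: le_trans ts (sa j x Ex).
  have z0 : 0 < z by exact: lt_le_trans (y_gt0 x Ex) yz.
  have cz := gmean_subst_div_anti theta_gt0 theta_sum j (a := a ^~ x)
     (fun i => lt_le_trans s0 (sa i x Ex)) (y_gt0 x Ex) yz.
  have Gz : Gamma x <= gmean theta (subst j z (a ^~ x)).
    apply: le_gmean => //; first by move=> i; exact: (a0 i).2.
    move=> i; rewrite /subst; case: eqP => // ->.
    by rewrite lerDl mulr_ge0// ltW.
  have Gzy : Gamma x / (a j x * (1 + u)) <= gmean theta (c ^~ x) / y x.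
    apply: le_trans cz; apply: le_trans (_ : Gamma x / z <= _).
      by apply: ler_wpM2l; [exact: Gamma0.2|rewrite lef_pV2// posrE (lt_le_trans z0)].
    by apply: ler_wpM2r => //; rewrite invr_ge0 ltW.
  have -> : gmean theta (c ^~ x) * (b x / y x) = b x * (gmean theta (c ^~ x) / y x).
    by ring.
  have -> : (1 - eps) * (h x / (1 + u) * (Gamma x / a j x)) =
     (1 - eps) * h x * (Gamma x / (a j x * (1 + u))).
    by rewrite invfM; ring.
  apply: ler_pM => //.
  - exact: mulr_ge0 (ltW eps1') hx.
  - apply: divr_ge0; first exact: Gamma0.2.
    exact: mulr_ge0 (ltW ax) (addr_ge0 ler01 u0).
  - by rewrite /b lerDl; exact: mulr_ge0 (ltW eps0) ((G_nn (Ge j)).2 x).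
move=> /le_trans/(_ Q_le).
set J := (\int[mu]_(_ in E) _)%E => H.
have J0 : (0 <= J)%E by exact: nnintegral_ge0.
have Jfin : J \is a fin_num.
  rewrite ge0_fin_numE// ltNge leye_eq; apply/negP => /eqP Joo.
  by move: H; rewrite Joo gt0_muley ?lte_fin// leye_eq.
move: J0 H; rewrite -(fineK Jfin) -EFinM !lee_fin; move: (fine J) => r r0.
have etaE : eta / (theta j * t) <= (B - A) / 2.
  rewrite ler_pdivrMr ?mulr_gt0// [leRHS]mulrC /eta; apply: ler_wpM2r.
    by rewrite divr_ge0// subr_ge0 ltW.
  by apply: ler_wpM2r; [exact: ltW|exact: theta0_le].
have At : A / (1 - t) <= (1 - eps) * B - (B - A) / 2.
  rewrite ler_pdivrMr ?subr_gt0//.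
  have : (1 - eps) * B * (1 - eps) <= (1 - eps) * B * (1 - t).
    by rewrite ler_pM2l ?mulr_gt0// lerD2l lerN2.
  nra.
move=> H; have : (1 - eps) * r <= (1 - eps) * B by lra.
by rewrite ler_pM2l.
Qed.

End ApproximateWeights.

(** * A finite measure that detects null sets *)

(** Sum the restrictions of [mu] to countably many sets of finite measure, with
    weights that make the total at most [1]. *)
Lemma finite_dominating_measure (R : realType) (dd : measure_display)
    (X : measurableType dd) (mu : {sigma_finite_measure set X -> \bar R}) :
  exists nu : {measure set X -> \bar R}, (nu setT < +oo)%E /\
    forall N, measurable N -> nu N = 0%E -> mu N = 0%E.
Proof.
have [F TF mF] := sigma_finiteT mu.
pose r n : R := (2 ^ n.+1)%:R^-1 / (1 + fine (mu (F n))).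
have r_gt0 n : 0 < r n.
  by rewrite divr_gt0// ?invr_gt0 ?ltr0n ?expn_gt0// ltr_wpDr// fine_ge0.
pose rn n : {nonneg R} := NngNum (ltW (r_gt0 n)).
pose nun n : {measure set X -> \bar R} := mscale (rn n) (mrestr mu (mF n).1).
exists (mseries nun 0); split.
  rewrite /=; apply: le_lt_trans (ltry 1).
  apply: le_trans (epsilon_trick0 xpredT ler01).
  apply: lee_nneseries => // n _.
  rewrite /= /mscale /= /mrestr setTI.
  have Fn := (mF n).2.
  have Ffin : mu (F n) \is a fin_num by rewrite ge0_fin_numE.
  rewrite -(fineK Ffin) -EFinM lee_fin /r.
  have f0 : 0 <= fine (mu (F n)) by rewrite fine_ge0.
  rewrite -mulrA [leRHS]mulrC; apply: ler_wpM2l.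
    by rewrite invr_ge0.
  rewrite mulrC ler_pdivrMr ?mul1r ?lerDr//.
  by rewrite ltr_wpDr.
move=> N mN nuN.
have NF : N = \bigcup_n (N `&` F n) by rewrite -setI_bigcupr -TF setIT.
apply/negligibleP => //; rewrite NF; apply: negligible_bigcup => n.
apply/negligibleP; first by apply: measurableI => //; exact: (mF n).1.
have : (nun n N <= mseries nun 0 N)%E.
  rewrite /mseries; apply: le_trans (nneseries_lim_ge n.+1 _) => //.
  rewrite big_nat_recr//= leeDr//.
  exact: sume_ge0.
rewrite /= nuN => nunN.
have : nun n N = 0%E by apply/eqP; rewrite eq_le nunN measure_ge0.
rewrite /= /mscale /= /mrestr => /eqP.
by rewrite mule_eq0 eqe gt_eqF//= => /eqP.
Qed.


(** * Almost everywhere convergence *)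

Section AlmostEverywhereConvergence.
Context {R : realType} {dd : measure_display} {X : measurableType dd}.

Lemma integral_lty_ae (mu : {measure set X -> \bar R}) (f : X -> \bar R) :
  measurable_fun [set: X] f -> (forall x, 0 <= f x)%E ->
  (\int[mu]_x f x < +oo)%E -> {ae mu, forall x, (f x < +oo)%E}.
Proof.
move=> mf f0 fin.
have fint : mu.-integrable setT f.
  apply/integrableP; split=> //.
  by under eq_integral do rewrite gee0_abs//.
apply: filterS (integrable_ae measurableT fint) => x /(_ I).
by rewrite ge0_fin_numE.
Qed.

(** By [|y| <= 1/w + w y^2] with [w = 2^(k+1)], the increments are absolutely
    summable. *)
Lemma square_summable_increments_cvg (u D : nat -> R) :
  (forall k, (u k.+1 - u k) ^+ 2 <= D k) ->
  (\sum_(k <oo) ((2 ^ k.+1)%:R * D k)%:E < +oo)%E -> cvgn u.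
Proof.
move=> uD DS.
pose w k : R := (2 ^ k.+1)%:R.
have w0 k : 0 < w k by rewrite ltr0n expn_gt0.
have D0 k : 0 <= D k by apply: le_trans (uD k); exact: sqr_ge0.
set S := (\sum_(k <oo) _)%E in DS.
have Sfin : S \is a fin_num.
  rewrite ge0_fin_numE//; apply: nneseries_ge0 => k _ _.
  by rewrite lee_fin mulr_ge0// ltW.
suff cs : cvgn (series (telescope u)).
  rewrite (_ : u = fun n => u 0%N + series (telescope u) n).
    by apply: is_cvgD => //; exact: is_cvg_cst.
  by apply/funext => n; exact: eq_sum_telescope.
suff : cvgn (series (fun k => `|telescope u k|)) by exact: normed_cvg.
apply: nondecreasing_is_cvgn.
  by apply/nondecreasing_seqP => n; rewrite !seriesEnat/= big_nat_recr//= lerDl normr_ge0.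
exists (1 + fine S) => _ [n _ <-].
rewrite -lee_fin EFinD (fineK Sfin) seriesEnat/= -sumEFin.
apply: (@le_trans _ _ (\sum_(0 <= k < n) ((1 / w k)%:E + (w k * D k)%:E))%E).
  apply: lee_sum => k _; rewrite -EFinD lee_fin.
  apply: (@le_trans _ _ (1 / w k + w k * (u k.+1 - u k) ^+ 2)); last first.
    by rewrite lerD2l ler_pM2l.
  rewrite /telescope -real_normK ?num_real//.
  set y := `|_|; have y0 : 0 <= y by exact: normr_ge0.
  rewrite -(ler_pM2l (w0 k)) mulrDr [w k * (_ / _)]mulrC divfK ?gt_eqF//.
  by have := sqr_ge0 (w k * y - 1 / 2); nra.
rewrite big_split/=; apply: leeD.
  apply: le_trans (epsilon_trick0 xpredT ler01).
  apply: nneseries_lim_ge => k _ _; rewrite lee_fin; exact: divr_ge0 (ltW (w0 k)).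
by apply: nneseries_lim_ge => k _ _; rewrite lee_fin mulr_ge0// ltW.
Qed.

End AlmostEverywhereConvergence.

(** * Convergent sequences in decreasing convex sets *)

Definition midpoint (R : realType) (I X : Type) (f g : I -> X -> R) : I -> X -> R :=
  fun j x => (f j x + g j x) / 2.

Section ConvexSelection.
Context {R : realType} {dd : measure_display} {X : measurableType dd}.
Variable nu : {measure set X -> \bar R}.
Hypothesis nu_fin : (nu setT < +oo)%E.
Variables (I : finType) (C : nat -> set (I -> X -> R)).
Hypothesis C_nonempty : forall m, C m !=set0.
Hypothesis C_decr : forall m n, (m <= n)%N -> C n `<=` C m.
Hypothesis C_midpoint : forall m f g, C m f -> C m g ->
  C m (midpoint f g).
Hypothesis C_nn : forall m f, C m f -> forall j, nnmeasurable (f j).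

(** Strong convexity of [1/(1 + a)], measured by the values of the function
    itself.  In terms of [p = 1/(1 + a)] and [q = 1/(1 + b)] the defect of convexity is
    [(p - q)^2 / (2 (p + q))], and [p + q <= 2]. *)
Lemma midpoint_inv_le (a b : R) : 0 <= a -> 0 <= b ->
  (1 + (a + b) / 2)^-1 + ((1 + a)^-1 - (1 + b)^-1) ^+ 2 / 4
  <= ((1 + a)^-1 + (1 + b)^-1) / 2.
Proof.
move=> a0 b0.
have Ha : (1 + a)^-1 * (1 + a) = 1 by rewrite mulVf// gt_eqF// ltr_wpDr.
have Hb : (1 + b)^-1 * (1 + b) = 1 by rewrite mulVf// gt_eqF// ltr_wpDr.
have m0 : 0 < 1 + (a + b) / 2 by lra.
have va : 0 < (1 + a)^-1 by rewrite invr_gt0; lra.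
have vb : 0 < (1 + b)^-1 by rewrite invr_gt0; lra.
set p := (1 + a)^-1 in Ha va *; set q := (1 + b)^-1 in Hb vb *.
have pqN0 : p + q != 0 by rewrite gt_eqF// addr_gt0.
have pN0 : p != 0 by rewrite gt_eqF.
have qN0 : q != 0 by rewrite gt_eqF.
have -> : (1 + (a + b) / 2)^-1 = 2 * p * q / (p + q).
  have aE : a = p^-1 - 1 by rewrite /p invrK; ring.
  have bE : b = q^-1 - 1 by rewrite /q invrK; ring.
  rewrite aE bE; field.
  by rewrite pqN0 qN0 pN0.
have p1 : p <= 1 by nra.
have q1 : q <= 1 by nra.
have -> : 2 * p * q / (p + q) = (p + q) / 2 - (p - q) ^+ 2 / (2 * (p + q)).
  by field.
have : (p - q) ^+ 2 / 4 <= (p - q) ^+ 2 / (2 * (p + q)).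
  by apply: ler_wpM2l; [exact: sqr_ge0|rewrite lef_pV2 ?posrE; lra].
lra.
Qed.

Let recip (f : I -> X -> R) x : R := \sum_j (1 + f j x)^-1.
Let gap (f g : I -> X -> R) x : R := \sum_j ((1 + f j x)^-1 - (1 + g j x)^-1) ^+ 2.
Let energy f : \bar R := (\int[nu]_x (recip f x)%:E)%E.

Let recip_nn m f : C m f -> nnmeasurable (recip f).
Proof.
move=> Cf; apply: nnmeasurable_sum => j; apply: nnmeasurable_inv.
by apply: nnmeasurable_add; [exact: nnmeasurable_cst|exact: C_nn Cf j].
Qed.

Let gap_nn m f g : C m f -> C m g -> nnmeasurable (gap f g).
Proof.
have inv_nn h j : C m h -> nnmeasurable (fun x => (1 + h j x)^-1).
  move=> Ch; apply: nnmeasurable_inv.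
  by apply: nnmeasurable_add; [exact: nnmeasurable_cst|exact: C_nn Ch j].
move=> Cf Cg; apply: nnmeasurable_sum => j; split; last by move=> x; exact: sqr_ge0.
by apply: measurable_funX; apply: measurable_funB; exact: (inv_nn _ _ _).1.
Qed.

Let bound := (#|I|%:R%:E * nu setT)%E.

Let energy_le m f : C m f -> (0 <= energy f <= bound)%E.
Proof.
move=> Cf; rewrite nnintegral_ge0/=; last exact: recip_nn Cf.
rewrite /bound -integral_cst//; apply: (le_nnintegral _ (g := fun=> #|I|%:R)) => //.
  exact: recip_nn Cf.
move=> x _; rewrite /recip; apply: (@le_trans _ _ (\sum_(j : I) 1)).
  apply: ler_sum => j _; have f0 := (C_nn Cf j).2 x.
  by rewrite invf_le1 ?lerDl// ltr_wpDr.
by rewrite big_const iter_addr_0 cardT.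
Qed.

Let bound_fin : bound \is a fin_num.
Proof. by rewrite fin_numM// ge0_fin_numE. Qed.

Let energy_fin m f : C m f -> energy f \is a fin_num.
Proof.
move=> /energy_le/andP[f0 fB]; rewrite ge0_fin_numE//.
by apply: le_lt_trans fB _; rewrite -ge0_fin_numE// mule_ge0.
Qed.

Let gap_le m f g : C m f -> C m g ->
  (4^-1%:E * \int[nu]_x (gap f g x)%:E + energy (midpoint f g)
   <= 2^-1%:E * energy f + 2^-1%:E * energy g)%E.
Proof.
move=> Cf Cg; have Cm := C_midpoint Cf Cg.
rewrite -[X in (_ + X)%E]mul1e -!nnintegral_lincomb//;
  try exact: recip_nn Cf; try exact: recip_nn Cg; try exact: recip_nn Cm;
  try exact: gap_nn Cf Cg; try (by rewrite invr_ge0).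
apply: le_nnintegral => //.
- by apply: nnmeasurable_add; apply: nnmeasurable_mul;
   try exact: nnmeasurable_cst; [exact: gap_nn Cf Cg|exact: recip_nn Cm].
- by apply: nnmeasurable_add; apply: nnmeasurable_mul;
   try exact: nnmeasurable_cst; [exact: recip_nn Cf|exact: recip_nn Cg].
move=> x _; rewrite /recip /gap !mulr_sumr -!big_split/=.
apply: ler_sum => j _.
have := midpoint_inv_le ((C_nn Cf j).2 x) ((C_nn Cg j).2 x); lra.
Qed.

Let infimum m : \bar R := ereal_inf (energy @` C m).

Let infimum_ge0 m : (0 <= infimum m)%E.
Proof. by apply: le_ereal_inf_tmp => _ [f Cf <-]; case/andP: (energy_le Cf). Qed.

Let infimum_le m f : C m f -> (infimum m <= energy f)%E.
Proof. by move=> Cf; apply: ereal_inf_lbound; exists f. Qed.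

Let infimum_fin m : infimum m \is a fin_num.
Proof.
have [f Cf] := C_nonempty m.
rewrite ge0_fin_numE//; apply: le_lt_trans (infimum_le Cf) _.
have := energy_fin Cf; rewrite ge0_fin_numE//; by case/andP: (energy_le Cf).
Qed.

Let infimum_decr m n : (m <= n)%N -> (infimum m <= infimum n)%E.
Proof.
move=> mn; apply: le_ereal_inf_tmp => _ [f Cf <-]; apply: infimum_le.
exact: C_decr Cf.
Qed.

Let limit : \bar R := ereal_sup (range infimum).

Let limit_fin : limit \is a fin_num.
Proof.
have l0 : (0 <= limit)%E.
  by apply: le_trans (infimum_ge0 0) _; apply: ereal_sup_ubound; exists 0%N.
rewrite ge0_fin_numE//; apply: (@le_lt_trans _ _ bound); last first.
  by rewrite -ge0_fin_numE// mule_ge0.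
apply: ge_ereal_sup => _ [m _ <-]; have [f Cf] := C_nonempty m.
by apply: le_trans (infimum_le Cf) _; case/andP: (energy_le Cf).
Qed.

Let near_minimizer (k : nat) (delta : R) : 0 < delta ->
  exists mf : nat * (I -> X -> R), [/\ (k <= mf.1)%N, C mf.1 mf.2,
    (energy mf.2 <= limit + delta%:E)%E &
    (limit - delta%:E <= infimum mf.1)%E].
Proof.
move=> delta0.
have [_ [m _ <-] lm] := ub_ereal_sup_adherent delta0 limit_fin.
have [_ [f Cf <-] fm] := lb_ereal_inf_adherent delta0 (infimum_fin (maxn k m)).
exists (maxn k m, f); split => //=; first exact: leq_maxl.
  apply: le_trans (ltW fm) _; rewrite leeD2r//.
  by apply: ereal_sup_ubound; exists (maxn k m).
by apply: le_trans (ltW lm) _; exact: infimum_decr (leq_maxr _ _).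
Qed.

(** The infima of [energy] over the sets [C m] increase to a finite limit.
    Near-minimisers taken from late sets have energies close to that limit, and so
    has the midpoint of any two of them; by strong convexity their reciprocals
    [1/(1 + f)] are then close in mean square.  Square-summable errors give
    convergence almost everywhere.  Passing to reciprocals allows [f] itself to tend
    to [+oo]. *)
Lemma convex_sets_ae_cvg : exists f : nat -> I -> X -> R,
  (forall k, C k (f k)) /\
  {ae nu, forall x, forall j, cvgn (fun k => (1 + f k j x)^-1)}.
Proof.
(* With this slack the gap between consecutive functions has integral at most
   [8 delta k]; a factor [2^(k+1)] in the denominator pays for the weight in
   [square_summable_increments_cvg], the other one makes the series converge. *)
pose delta k : R := (8 * (2 ^ k.+1)%:R * (2 ^ k.+1)%:R)^-1.
have w0 k : 0 < (2 ^ k.+1)%:R :> R by rewrite ltr0n expn_gt0.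
have delta0 k : 0 < delta k by rewrite invr_gt0 !mulr_gt0.
have [mf mfP] := choice (fun k => near_minimizer k (delta0 k)).
pose f k := (mf k).2.
exists f; split.
  by move=> k; have [km Cf _ _] := mfP k; exact: C_decr Cf.
have gap0 k : nnmeasurable (gap (f k.+1) (f k)).
  have [km Cf _ _] := mfP k; have [km' Cf' _ _] := mfP k.+1.
  by apply: (@gap_nn 0); [exact: C_decr Cf'|exact: C_decr Cf].
have delta_decr k : delta k.+1 <= delta k.
  rewrite lef_pV2 ?posrE ?mulr_gt0//.
  have : (2 ^ k.+1)%:R <= (2 ^ k.+2)%:R :> R by rewrite ler_nat leq_exp2l.
  have := w0 k; nra.
have gap_small k : (\int[nu]_x (gap (f k.+1) (f k) x)%:E <= (8 * delta k)%:E)%E.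
  have [km Cf fle fge] := mfP k; have [km' Cf' fle' fge'] := mfP k.+1.
  pose m := minn (mf k).1 (mf k.+1).1.
  have Cm : C m (f k) by apply: C_decr Cf; exact: geq_minl.
  have Cm' : C m (f k.+1) by apply: C_decr Cf'; exact: geq_minr.
  have dk : (limit - (delta k)%:E <= infimum m)%E.
    rewrite /m /minn; case: ifP => _ //.
    by apply: le_trans fge'; rewrite leeB// lee_fin.
  have mid := infimum_le (C_midpoint Cm' Cm).
  have := gap_le Cm' Cm.
  move: fle fle' dk mid; rewrite -/(f k) -/(f k.+1).
  rewrite -(fineK (energy_fin Cm)) -(fineK (energy_fin Cm')).
  rewrite -(fineK (energy_fin (C_midpoint Cm' Cm))).
  rewrite -(fineK limit_fin) -(fineK (infimum_fin m)).
  have D0 : (0 <= \int[nu]_x (gap (f k.+1) (f k) x)%:E)%E by exact: nnintegral_ge0.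
  move: (fine (energy (f k))) (fine (energy (f k.+1))) (fine (energy _)) (fine limit)
    (fine (infimum m)) => a b c l i.
  case: (\int[nu]_x _)%E D0 => [D|//|//]; last by rewrite gt0_muley ?lte_fin.
  rewrite -!EFinM -!EFinD !lee_fin; have := delta_decr k; lra.
have S_fin : (\int[nu]_x (\sum_(k <oo) ((2 ^ k.+1)%:R * gap (f k.+1) (f k) x)%:E)
              < +oo)%E.
  have tm k : nnmeasurable (fun x => (2 ^ k.+1)%:R * gap (f k.+1) (f k) x).
    by apply: nnmeasurable_mul => //; exact: nnmeasurable_cst.
  rewrite integral_nneseries//; last 2 first.
    by move=> k; exact: nnmeasurable_EFin (tm k).
    by move=> k x _; rewrite lee_fin (tm k).2.
  apply: le_lt_trans (ltry 1); apply: le_trans (epsilon_trick0 xpredT ler01).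
  apply: lee_nneseries => [k _ _|k _]; first exact: nnintegral_ge0.
  rewrite nnintegralZ//; apply: le_trans (_ : (2 ^ k.+1)%:R%:E * (8 * delta k)%:E <= _)%E.
    by apply: lee_wpmul2l => //; rewrite lee_fin ltW.
  rewrite -EFinM lee_fin /delta mul1r le_eqVlt; apply/orP; left; apply/eqP.
  have := w0 k; move: (2 ^ k.+1)%:R => w w_gt0.
  by field; rewrite gt_eqF.
apply: filterS (integral_lty_ae _ _ S_fin) => [x xfin j||].
- apply: square_summable_increments_cvg xfin => k.
  rewrite /gap (bigD1 j)//= lerDl; apply: sumr_ge0 => i _; exact: sqr_ge0.
- apply: ge0_emeasurable_sum => k.
    by move=> x _ _; rewrite lee_fin mulr_ge0 ?(gap0 k).2.
  move=> _; apply/measurable_EFinP; apply: measurable_funM => //; exact: (gap0 k).1.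
- by move=> x; apply: nneseries_ge0 => k _ _; rewrite lee_fin mulr_ge0 ?(gap0 k).2.
Qed.

End ConvexSelection.

(** * Countable exhaustion by a saturating family *)

Section Exhaustion.
Context {R : realType} {dd : measure_display} {X : measurableType dd}.

Lemma measurable_pos (g : X -> R) : nnmeasurable g -> measurable [set x | 0 < g x].
Proof.
move=> [mg _]; rewrite -[X in measurable X]setTI.
rewrite [X in _ `&` X](_ : _ = g @^-1` `]0, +oo[); last first.
  by apply/seteqP; split=> x /=; rewrite in_itv/= andbT.
exact: mg.
Qed.

(** Choose [h k] so that the [nu]-measures of [{h k > 0}] approach their
    supremum.  If a set of positive measure were missed by all of them, saturation
    would give a [g] positive on part of it, and averaging [g] with some [h k] would
    exceed the supremum. *)
Lemma saturating_sequence (mu nu : {measure set X -> \bar R}) (G : set (X -> R)) :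
  (nu setT < +oo)%E -> (forall N, measurable N -> nu N = 0%E -> mu N = 0%E) ->
  (forall g, G g -> nnmeasurable g) ->
  (forall g h t, 0 <= t <= 1 -> G g -> G h ->
    G (fun x => (1 - t) * g x + t * h x)) ->
  saturates mu G -> G !=set0 ->
  exists h : nat -> X -> R, (forall k, G (h k)) /\
    {ae mu, forall x, exists k, 0 < h k x}.
Proof.
move=> nufin dom Gnn Gconv Gsat [g0 Gg0].
pose pos (g : X -> R) := [set x | 0 < g x].
have fin_nu (B : set X) : measurable B -> nu B \is a fin_num.
  move=> mB; rewrite ge0_fin_numE//; apply: le_lt_trans nufin.
  by apply: le_measure; rewrite ?inE.
pose S := [set nu (pos g) | g in G].
have Sfin : ereal_sup S \is a fin_num.
  rewrite ge0_fin_numE; last first.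
    by apply: le_trans (measure_ge0 nu (pos g0)) _; apply: ereal_sup_ubound; exists g0.
  apply: le_lt_trans nufin; apply: ge_ereal_sup => _ [g Gg <-].
  by apply: le_measure; rewrite ?inE//; exact: measurable_pos (Gnn _ Gg).
have near_sup k : exists g, G g /\ (ereal_sup S - (k.+1%:R^-1)%:E < nu (pos g))%E.
  have k0 : 0 < k.+1%:R^-1 :> R by rewrite invr_gt0.
  by have [_ [g Gg <-] ?] := ub_ereal_sup_adherent k0 Sfin; exists g.
have [h hP] := choice near_sup.
exists h; split; first by move=> k; exact: (hP k).1.
have mU : measurable (\bigcup_k pos (h k)).
  by apply: bigcupT_measurable => k; exact: measurable_pos (Gnn _ (hP k).1).
pose E := ~` (\bigcup_k pos (h k)).
have mE : measurable E by exact: measurableC.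
have [E0|Epos] := eqVneq (mu E) 0%E.
  by exists E; split => // x /= nx [k _ hk]; apply: nx; exists k.
have {}Epos : (0 < mu E)%E by rewrite lt_neqAle eq_sym Epos measure_ge0.
have [E' [g [mE' E'E E'pos Gg gE']]] := Gsat _ mE Epos.
have nuE' : (0 < nu E')%E.
  rewrite lt_neqAle measure_ge0 andbT eq_sym; apply/eqP => nu0.
  by move: E'pos; rewrite (dom _ mE' nu0) ltxx.
have c0 : 0 < fine (nu E') by rewrite fine_gt0// nuE' -ge0_fin_numE ?fin_nu//.
have [k kc] : exists k, k.+1%:R^-1 < fine (nu E').
  have [k] := ltr_add_invr c0.
  by rewrite add0r; exists k.
have [Ghk hk] := hP k.
have half01 : 0 <= (1 / 2 : R) <= 1 by apply/andP; split; lra.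
have := Gconv _ _ _ half01 Ghk Gg.
set m := (fun x => _) => Gm.
have : (nu (pos m) <= ereal_sup S)%E by apply: ereal_sup_ubound; exists m.
have : (nu (pos (h k)) + nu E' <= nu (pos m))%E.
  have mh := measurable_pos (Gnn _ Ghk).
  rewrite -measureU//; last first.
    apply/seteqP; split => // x [hx E'x]; apply: (E'E x E'x); by exists k.
  apply: le_measure; rewrite ?inE; [exact: measurableU|exact: measurable_pos (Gnn _ Gm)|].
  have h0 x := (Gnn _ Ghk).2 x; have g0' x := (Gnn _ Gg).2 x.
  move=> x [hx|/gE' gx]; rewrite /pos /= /m.
    by have := g0' x; rewrite /pos/= in hx; lra.
  by have := h0 x; lra.
move: hk.
rewrite -(fineK Sfin) -(fineK (fin_nu _ mE')) -(fineK (fin_nu _ (measurable_pos (Gnn _ Ghk)))).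
rewrite -(fineK (fin_nu _ (measurable_pos (Gnn _ Gm)))).
rewrite -EFinB -EFinD !lee_fin lte_fin => lo add hi; exfalso.
have := ltrD kc lo; rewrite addrC subrK addrC => sup_lt.
by have := lt_le_trans sup_lt (le_trans add hi); rewrite ltxx.
Qed.

End Exhaustion.

(** * Lower limits and truncations *)

Section LowerLimits.
Context {R : realType}.
Local Open Scope ereal_scope.

Lemma limn_einf_ge0 (u : nat -> \bar R) :
  (forall n, 0 <= u n) -> 0 <= limn_einf u.
Proof.
move=> u0; rewrite limn_einf_lim; apply: lime_ge; first exact: is_cvg_einfs.
by apply: nearW => n; apply: le_ereal_inf_tmp => _ [k _ <-].
Qed.

Lemma limn_einf_le_cvg (u w : nat -> \bar R) (l : \bar R) :
  (forall n, u n <= w n) -> w @ \oo --> l -> limn_einf u <= l.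
Proof.
move=> uw wl; have <- := cvg_lim (@ereal_hausdorff R) wl.
rewrite limn_einf_lim; apply: lee_lim; first exact: is_cvg_einfs.
  by apply/cvg_ex; exists l.
apply: nearW => n; apply: le_trans (uw n).
by apply: ereal_inf_lbound; exists n => /=.
Qed.

Lemma measurable_fun_limn_einf (dd : measure_display) (X : measurableType dd)
    (f : nat -> X -> \bar R) : (forall n, measurable_fun [set: X] (f n)) ->
  measurable_fun [set: X] (fun x => limn_einf (f^~ x)).
Proof.
move=> mf.
rewrite (_ : (fun x => _) = (fun x => - limn_esup (fun n => - f n x))).
  apply: measurableT_comp => //; apply: measurable_fun_limn_esup => n.
  exact: measurableT_comp.
apply/funext => x; rewrite -limn_einfN; congr limn_einf.
by apply/funext => n /=; rewrite oppeK.
Qed.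

End LowerLimits.

Section PointwiseLimits.
Context {R : realType}.
Implicit Types (u : nat -> R).

(** Continuity of [x ^ q] up to the endpoint [0], where the derivative may be
    infinite. *)
Lemma cvg_powR q u l : 0 < q -> (forall k, 0 <= u k) -> u @ \oo --> l ->
  (fun k => u k `^ q) @ \oo --> l `^ q.
Proof.
move=> q0 u0 ul.
have l0 : 0 <= l.
  have <- := cvg_lim (@Rhausdorff R) ul.
  by apply: limr_ge; [apply/cvg_ex; exists l|exact: nearW].
have [l_gt0|] := ltP 0 l; last first.
  move=> l_le0; have -> : l = 0 by apply/eqP; rewrite eq_le l0 l_le0.
  rewrite powR0 ?gt_eqF//; apply/cvgrPdist_lt => e e0.
  have lE : l = 0 by apply/eqP; rewrite eq_le l0 l_le0.
  have d0 : 0 < e `^ q^-1 by exact: powR_gt0.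
  move/cvgrPdist_lt : ul => /(_ _ d0); apply: filterS => k.
  rewrite lE !sub0r !normrN !ger0_norm ?powR_ge0// => uk.
  have -> : e = (e `^ q^-1) `^ q by rewrite -powRrM mulVf ?gt_eqF// powRr1// ltW.
  by apply: gt0_ltr_powR => //; rewrite ?nnegrE// ltW.
have cl : {for l, continuous (@powR R ^~ q)}.
  apply: differentiable_continuous; apply/derivable1_diffP.
  by apply: derivable_powR; rewrite in_itv/= l_gt0.
exact: (cvg_comp _ _ ul cl).
Qed.

Lemma cvg_gmean (I : finType) (theta : I -> R) (f : nat -> I -> R) (l : I -> R) :
  (forall i, 0 < theta i) -> (forall k i, 0 <= f k i) ->
  (forall i, (fun k => f k i) @ \oo --> l i) ->
  (fun k => gmean theta (f k)) @ \oo --> gmean theta l.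
Proof.
move=> th0 f0 fl; rewrite /gmean.
apply: (@cvg_big R I *%R 1 xpredT _ nat \oo _ (fun i k => f k i `^ theta i)).
  exact: mul_continuous.
by move=> i _; exact: cvg_powR.
Qed.

Section Truncation.
Variables (f : nat -> R) (h v : R).
Hypothesis f_ge0 : forall k, 0 <= f k.
Hypothesis h_ge0 : 0 <= h.
Hypothesis inv_cvg : (fun k => (1 + f k)^-1) @ \oo --> v.

Let truncated k : \bar R := (h / (1 + h / k.+1%:R) * f k)%:E.

Lemma cvg_of_inv : 0 < v -> f @ \oo --> v^-1 - 1.
Proof.
move=> v0; have -> : f = fun k => ((1 + f k)^-1)^-1 - 1.
  by apply/funext => k; rewrite invrK addrC addKr.
by apply: cvgB; [apply: cvgV => //; rewrite gt_eqF|exact: cvg_cst].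
Qed.

Lemma limn_einf_truncated : 0 < v -> limn_einf truncated = (h * (v^-1 - 1))%:E.
Proof.
move=> v0; apply: (cvg_limn_einf_sup _).1.
apply: cvg_EFin; first exact: nearW.
rewrite [X in X @ _](_ : _ = (fun k => h / (1 + h / k.+1%:R) * f k)); last first.
  by apply/funext.
apply: cvgM; last exact: cvg_of_inv.
rewrite -[X in _ --> X]divr1; apply: cvgM; first exact: cvg_cst.
apply: cvgV; first exact: oner_neq0.
rewrite -[X in _ --> X]addr0; apply: cvgD; first exact: cvg_cst.
rewrite -[X in _ --> X](mulr0 h); apply: cvgM; first exact: cvg_cst.
exact: cvg_harmonic.
Qed.

(** The truncations never fall below [h / (1 + h) > 0], so they cannot
    compensate for [f k] tending to [+oo]. *)
Lemma limn_einf_truncated_pinfty : v = 0 -> 0 < h -> limn_einf truncated = +oo%E.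
Proof.
move=> v0 h0; apply: (cvg_limn_einf_sup _).1.
apply/cvgeyPge => M.
pose c := h / (1 + h).
have c0 : 0 < c by rewrite divr_gt0// addr_gt0.
pose e := (1 + `|M| / c)^-1.
have e0 : 0 < e by rewrite invr_gt0 ltr_pwDl// divr_ge0// ltW.
move/cvgrPdist_lt : inv_cvg => /(_ _ e0); apply: filterS => k.
rewrite v0 sub0r normrN ger0_norm ?invr_ge0 ?addr_ge0// => lt_e.
have fk : `|M| / c <= f k.
  move: lt_e; rewrite /e ltf_pV2 ?posrE; last 2 first.
    by rewrite ltr_pwDl.
    by rewrite ltr_pwDl// divr_ge0// ltW.
  by rewrite ltrD2l => /ltW.
rewrite lee_fin; apply: le_trans (ler_norm M) _.
move: fk; rewrite ler_pdivrMr// mulrC => /le_trans; apply.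
apply: ler_wpM2r => //; rewrite /c; apply: ler_wpM2l => //.
rewrite lef_pV2 ?posrE; [|by rewrite addr_gt0|by rewrite ltr_pwDl// divr_ge0].
rewrite lerD2l ler_pdivrMr// ler_peMr//.
by rewrite ler1n.
Qed.

End Truncation.

End PointwiseLimits.

(** * Duality for convex families of functions *)

Section MultilinearDuality.
Context {R : realType} {dd : measure_display} {X : measurableType dd}.
Variables (mu : {sigma_finite_measure set X -> \bar R}).
Variables (I : finType) (theta : I -> R).
Hypothesis theta_gt0 : forall i, 0 < theta i.
Hypothesis theta_sum : \sum_i theta i = 1.
Variables (G : I -> set (X -> R)) (A : R).
Hypothesis G_nonempty : forall j, G j !=set0.
Hypothesis G_nn : forall j g, G j g -> nnmeasurable g.
Hypothesis G_convex : forall j g h t, 0 <= t <= 1 -> G j g -> G j h ->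
  G j (fun x => (1 - t) * g x + t * h x).
Hypothesis G_saturates : forall j, saturates mu (G j).
Hypothesis G_bound : forall g : I -> X -> R, (forall j, G j (g j)) ->
  (\int[mu]_x (gmean theta (g^~ x))%:E <= A%:E)%E.

Lemma average_mem (j : I) (h : nat -> X -> R) n : (forall k, G j (h k)) ->
  G j (fun x => (\sum_(k < n.+1) h k x) / n.+1%:R).
Proof.
move=> Gh; elim: n => [|n IH].
  rewrite [X in G j X](_ : _ = h 0%N)//.
  by apply/funext => x; rewrite big_ord1 divr1.
pose t : R := n.+2%:R^-1.
have t01 : 0 <= t <= 1 by rewrite invr_ge0 ler0n/= invf_le1// ler1n.
have := G_convex t01 IH (Gh n.+1); congr (G j _).
apply/funext => x; rewrite [in RHS]big_ord_recr/=.
rewrite /t -(natr1 n.+1); field.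
by rewrite !gt_eqF//; have := ler0n R n; lra.
Qed.

(** With [h_j,k] the sequences of [saturating_sequence], [e n j] is the average
    of the first [n + 1] of them, and [E n] is where all the sums (not the averages)
    are at least [1/(n + 1)]: sums increase with [n], hence so do the sets. *)
Lemma exhausting_sets : exists (E : nat -> set X) (e : nat -> I -> X -> R)
    (delta : nat -> R),
  [/\ forall n, measurable (E n), forall m n, (m <= n)%N -> E m `<=` E n,
      forall n j, G j (e n j),
      forall n, 0 < delta n /\ (forall j x, E n x -> delta n <= e n j x) &
      {ae mu, forall x, exists n, E n x}].
Proof.
have [nu [nu_fin nu_dom]] := finite_dominating_measure mu.
have [H HP] := choice (fun j => saturating_sequence nu_fin nu_dom
  (@G_nn j) (@G_convex j) (@G_saturates j) (G_nonempty j)).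
have H0 j k : nnmeasurable (H j k) by exact: G_nn ((HP j).1 k).
pose S n j x := \sum_(k < n.+1) H j k x.
have S0 n j : nnmeasurable (S n j) by exact: nnmeasurable_sum.
pose D n j := [set x | n.+1%:R^-1 <= S n j x].
exists (fun n => \bigcap_(j in [set: I]) D n j).
exists (fun n j x => S n j x / n.+1%:R), (fun n => n.+1%:R^-1 / n.+1%:R).
have D_incr j m n : (m <= n)%N -> D m j `<=` D n j.
  move=> mn x; rewrite /D /= => Dx; apply: (@le_trans _ _ m.+1%:R^-1).
    by rewrite lef_pV2 ?posrE// ler_nat.
  apply: le_trans Dx _; rewrite /S -!(big_mkord xpredT (fun k => H j k x)).
  rewrite [leRHS](@big_cat_nat _ _ _ m.+1)//= lerDl; apply: sumr_ge0 => k _.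
  exact: (H0 j k).2.
split.
- move=> n; apply: fin_bigcap_measurable => // j _.
  rewrite -[X in measurable X]setTI.
  rewrite [X in _ `&` X](_ : _ = S n j @^-1` `[n.+1%:R^-1, +oo[); last first.
    by apply/seteqP; split=> x /=; rewrite in_itv/= andbT.
  exact: (S0 n j).1.
- by move=> m n mn x Dm j Dj; exact: (D_incr j _ _ mn x (Dm j Dj)).
- by move=> n j; apply: average_mem => k; exact: (HP j).1.
- move=> n; split; first by rewrite divr_gt0// invr_gt0.
  by move=> j x Dx; apply: ler_wpM2r; [rewrite invr_ge0|exact: Dx].
have : {ae mu, forall x, forall j, exists k, 0 < H j k x}.
  by apply: filter_forall => j; exact: (HP j).2.
apply: filterS => x Hx.
have /choice [n Dn] j : exists n, D n j x.
  have [k Hk] := Hx j.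
  have [m] := ltr_add_invr Hk; rewrite add0r => mH.
  exists (maxn k m); rewrite /D /=; apply: (@le_trans _ _ m.+1%:R^-1).
    by rewrite lef_pV2 ?posrE// ler_nat ltnS leq_maxr.
  apply: le_trans (ltW mH) _; rewrite /S.
  rewrite (bigD1 (Ordinal (leq_maxl k m : (k < (maxn k m).+1)%N)))//= lerDl.
  by apply: sumr_ge0 => i _; exact: (H0 j i).2.
exists (\max_j n j)%N => j _.
by apply: (D_incr j (n j) _ _ _ (Dn j)); exact: leq_bigmax.
Qed.

(** The admissible tuples at stage [n], collected in [C n] below, are nonempty
    by [approximate_weights].  They decrease with [n] because the sets [E n] and the
    truncations increase.  They are stable under midpoints, since
    [((x + y)/2)^2 >= x y] and [gmean] is multiplicative.  A sequence [f k] in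
    [C k] with [1/(1 + f k)] convergent therefore exists, and [v] denotes the limit of
    the reciprocals, so that the limit weight is [1/v - 1] where [v > 0].
    By Fatou's lemma the lower limit of the truncated products [h f_k] has integral
    at most [A] for [h] in [G j], hence is finite almost everywhere.  It is [+oo]
    where [v = 0 < h], so saturation gives [v > 0] almost everywhere. *)
Lemma multilinear_duality : exists phi : I -> X -> R,
  [/\ forall j, nnmeasurable (phi j),
      {ae mu, forall x, 1 <= gmean theta (phi^~ x)} &
      forall j h, G j h -> (\int[mu]_x (h x * phi j x)%:E <= A%:E)%E].
Proof.
have [E [e [delta [mE E_incr Ge Edelta E_cover]]]] := exhausting_sets.
have [nu [nu_fin nu_dom]] := finite_dominating_measure mu.
pose trunc n (h : X -> R) x := h x / (1 + h x / n.+1%:R).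
have trunc_nn n h : nnmeasurable h -> nnmeasurable (trunc n h).
  move=> h0; apply: nnmeasurable_div => //.
  apply: nnmeasurable_add; first exact: nnmeasurable_cst.
  by apply: nnmeasurable_div => //; exact: nnmeasurable_cst.
pose C n := [set f : I -> X -> R | [/\ forall j, nnmeasurable (f j),
   {ae mu, forall x, E n x -> 1 <= gmean theta (f^~ x)} &
   forall j h, G j h ->
     (\int[mu]_x (trunc n h x * f j x)%:E <= (A + n.+1%:R^-1)%:E)%E]].
have C_nn n f : C n f -> forall j, nnmeasurable (f j) by case.
have C_nonempty n : C n !=set0.
  have An : A < A + n.+1%:R^-1 by rewrite ltrDl invr_gt0.
  have [delta0 eE] := Edelta n.
  have [f [f0 fE fG]] := approximate_weights theta_gt0 theta_sum G_nn G_convex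
    G_bound n (mE n) (Ge n) delta0 eE An.
  by exists f; split => //; apply: aeW => x Ex; rewrite fE.
have C_decr m n : (m <= n)%N -> C n `<=` C m.
  move=> mn f [f0 fE fG]; split=> //.
    by apply: filterS fE => x fx Emx; apply: fx; exact: E_incr Emx.
  move=> j h Gh; have h0 := G_nn Gh; apply: (@le_trans _ _ (A + n.+1%:R^-1)%:E).
    apply: le_trans (fG _ _ Gh).
    apply: le_nnintegral => //; try by apply: nnmeasurable_mul => //; exact: trunc_nn.
    move=> x _; apply: ler_wpM2r; first exact: (f0 j).2.
    apply: ler_wpM2l; first exact: h0.2.
    rewrite lef_pV2 ?posrE; try by rewrite ltr_pwDl// divr_ge0// h0.2.
    rewrite lerD2l; apply: ler_wpM2l; first exact: h0.2.
    by rewrite lef_pV2 ?posrE// ler_nat.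
  by rewrite lee_fin lerD2l lef_pV2 ?posrE// ler_nat.
have C_midpoint n f g : C n f -> C n g -> C n (midpoint f g).
  move=> [f0 fE fG] [g0 gE gG]; split.
  - move=> j; apply: nnmeasurable_mul; last by apply: nnmeasurable_cst; rewrite invr_ge0.
    exact: nnmeasurable_add.
  - apply: filterS2 fE gE => x fx gx Ex.
    have {}fx := fx Ex; have {}gx := gx Ex.
    have m0 i : 0 <= midpoint f g i x.
      by rewrite divr_ge0// addr_ge0 ?(f0 i).2 ?(g0 i).2.
    set m := gmean _ _.
    have m_ge0 : 0 <= m by exact: gmean_ge0.
    suff : 1 <= m * m by nra.
    rewrite /m -gmean_mul//.
    apply: (@le_trans _ _ (gmean theta (f ^~ x) * gmean theta (g ^~ x))); first nra.
    rewrite -gmean_mul => [|i|i]; [|exact: (f0 i).2|exact: (g0 i).2].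
    apply: le_gmean => // i; first by rewrite mulr_ge0 ?(f0 i).2 ?(g0 i).2.
    by rewrite /midpoint; have := sqr_ge0 (f i x - g i x); lra.
  move=> j h Gh; have th := trunc_nn n h (G_nn Gh).
  have -> : (\int[mu]_x (trunc n h x * midpoint f g j x)%:E =
     \int[mu]_x (2^-1 * (trunc n h x * f j x) + 2^-1 * (trunc n h x * g j x))%:E)%E.
    by apply: eq_integral => x _; rewrite /midpoint; congr _%:E; field.
  rewrite nnintegral_lincomb ?invr_ge0//; try exact: nnmeasurable_mul.
  apply: (@le_trans _ _ (2^-1%:E * (A + n.+1%:R^-1)%:E + 2^-1%:E * (A + n.+1%:R^-1)%:E)%E).
    by apply: leeD; apply: lee_wpmul2l; rewrite ?lee_fin ?invr_ge0//;
      [exact: fG|exact: gG].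
  by rewrite -!EFinM -EFinD lee_fin; move: (A + _) => r; lra.
have [f [Cf]] := convex_sets_ae_cvg nu_fin C_nonempty C_decr C_midpoint C_nn.
have f0 k j : nnmeasurable (f k j) by exact: C_nn (Cf k) j.
move=> f_cvg_nu.
have f_cvg : {ae mu, forall x, forall j, cvgn (fun k => (1 + f k j x)^-1)}.
  case: f_cvg_nu => N [mN nuN sub]; exists N; split=> //; exact: nu_dom.
(* The upper limit is measurable without any convergence assumption; the absolute
   value makes [v] nonnegative where the sequence diverges. *)
pose v j x : R := `|fine (limn_esup (fun k => ((1 + f k j x)^-1)%:E))|.
have inv_nn k j : nnmeasurable (fun x => (1 + f k j x)^-1).
  by apply: nnmeasurable_inv; apply: nnmeasurable_add => //; exact: nnmeasurable_cst.
have v0 j : nnmeasurable (v j).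
  pose w x := limn_esup (fun k => ((1 + f k j x)^-1)%:E).
  have mw : measurable_fun [set: X] w.
    apply: measurable_fun_limn_esup => k.
    exact: nnmeasurable_EFin (inv_nn k j).
  split=> [|x]; last exact: normr_ge0.
  have mfw : measurable_fun [set: X] (fine \o w) by exact: measurableT_comp.
  by apply: (measurableT_comp _ mfw); exact: normr_measurable.
have {}f_cvg : {ae mu, forall x, forall j, (fun k => (1 + f k j x)^-1) @ \oo --> v j x}.
  apply: filterS f_cvg => x fx j; have /cvg_ex[l /= fl] := fx j.
  suff -> : v j x = l by [].
  have l0 : 0 <= l.
    have <- := cvg_lim (@Rhausdorff R) fl.
    apply: limr_ge; first by apply/cvg_ex; exists l.
    by apply: nearW => k; exact: (inv_nn k j).2.
  have flE : (fun k => ((1 + f k j x)^-1)%:E) @ \oo --> l%:E.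
    by apply: cvg_EFin; [exact: nearW|exact: fl].
  by rewrite /v (cvg_limn_einf_sup flE).2 /= ger0_norm.
pose L j h x : \bar R := limn_einf (fun k => (trunc k h x * f k j x)%:E).
have fh_nn j h k : nnmeasurable h -> nnmeasurable (fun x => trunc k h x * f k j x).
  by move=> h0; apply: nnmeasurable_mul => //; exact: trunc_nn.
have mL j h : nnmeasurable h -> measurable_fun [set: X] (L j h).
  move=> h0; apply: measurable_fun_limn_einf => k.
  exact: nnmeasurable_EFin (fh_nn j h k h0).
have L0 j h : nnmeasurable h -> forall x, (0 <= L j h x)%E.
  move=> h0 x; apply: limn_einf_ge0 => k.
  by rewrite lee_fin; exact: (fh_nn j h k h0).2.
have L_le j h : G j h -> (\int[mu]_x L j h x <= A%:E)%E.
  move=> Gh; have h0 := G_nn Gh.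
  apply: le_trans (fatou _ _ _ _) _ => //.
  - by move=> k; exact: nnmeasurable_EFin (fh_nn j h k h0).
  - by move=> k x _; rewrite lee_fin; exact: (fh_nn j h k h0).2.
  apply: (limn_einf_le_cvg (w := fun k => (A + k.+1%:R^-1)%:E)).
    by move=> k; have [_ _] := Cf k; apply.
  apply: cvg_EFin; first exact: nearW.
  have : (fun k => A + harmonic k) @ \oo --> A + 0.
    by apply: cvgD; [exact: cvg_cst|exact: cvg_harmonic].
  by rewrite addr0.
have v_gt0 : {ae mu, forall x, forall j, 0 < v j x}.
  apply: filter_forall => j.
  pose N := ~` [set x | 0 < v j x].
  have mN : measurable N by apply: measurableC; exact: measurable_pos.
  have [N0|Npos] := eqVneq (mu N) 0%E; first by exists N; split.
  have {}Npos : (0 < mu N)%E by rewrite lt_neqAle eq_sym Npos measure_ge0.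
  have [E' [g [mE' E'N E'pos Gg gE']]] := @G_saturates j N mN Npos.
  have g0 := G_nn Gg.
  have Lfin := integral_lty_ae (mL j g g0) (L0 j g g0) (le_lt_trans (L_le j g Gg) (ltry _)).
  have notE' : {ae mu, forall x, ~ E' x}.
    apply: filterS2 Lfin f_cvg => x Lx fx E'x.
    have vx : v j x = 0.
      by apply/eqP; rewrite eq_le (v0 j).2 andbT leNgt; apply/negP; exact: (E'N x E'x).
    move: Lx; rewrite /L (limn_einf_truncated_pinfty _ _ (fx j)) ?ltxx//.
    - by move=> k; exact: (f0 k j).2.
    - exact: g0.2.
    - exact: gE'.
  have : mu.-negligible E'.
    case: notE' => B [mB muB sub]; exists B; split => // x E'x.
    by apply: sub => /=; apply.
  by move/(negligibleP mu mE') => E'0; move: E'pos; rewrite E'0 ltxx.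
(* The maximum only matters on the null set where [v] is [0] or exceeds [1]. *)
pose phi j x : R := Num.max 0 ((v j x)^-1 - 1).
have phi0 j : nnmeasurable (phi j).
  split; last by move=> x; rewrite le_max lexx.
  apply: measurable_maxr => //; apply: measurable_funB => //.
  exact: (nnmeasurable_inv (v0 j)).1.
have phiE : {ae mu, forall x, forall j, phi j x = (v j x)^-1 - 1 /\
    (fun k => f k j x) @ \oo --> phi j x}.
  apply: filterS2 f_cvg v_gt0 => x fx vx j.
  have cf := cvg_of_inv (fx j) (vx j).
  suff -> : phi j x = (v j x)^-1 - 1 by [].
  rewrite /phi max_r//.
  have <- := cvg_lim (@Rhausdorff R) cf.
  apply: limr_ge; first by apply/cvg_ex; exists ((v j x)^-1 - 1).
  by apply: nearW => k; exact: (f0 k j).2.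
exists phi; split => //.
- have f_ge1 : {ae mu, forall x, forall k, E k x -> 1 <= gmean theta (f k ^~ x)}.
    by apply/ae_foralln => k; have [_ + _] := Cf k.
  near=> x.
  have [n En] : exists n, E n x by near: x.
  have fx1 : forall k, E k x -> 1 <= gmean theta (f k ^~ x) by near: x.
  have phix : forall j, phi j x = (v j x)^-1 - 1 /\
    (fun k => f k j x) @ \oo --> phi j x by near: x.
  have cg : (fun k => gmean theta (f k ^~ x)) @ \oo --> gmean theta (phi ^~ x).
    apply: cvg_gmean => // [k i|i]; first exact: (f0 k i).2.
    exact: (phix i).2.
  have <- := cvg_lim (@Rhausdorff R) cg.
  apply: limr_ge; first by apply/cvg_ex; exists (gmean theta (phi ^~ x)).
  exists n => // k /= nk; apply: fx1; exact: E_incr En.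
- move=> j h Gh; have h0 := G_nn Gh.
  apply: le_trans (L_le j h Gh).
  have hphi0 : nnmeasurable (fun x => h x * phi j x) by exact: nnmeasurable_mul.
  apply: ae_ge0_le_integral => //.
  + by move=> x _; rewrite lee_fin hphi0.2.
  + exact: nnmeasurable_EFin.
  + by move=> x _; exact: L0.
  + exact: mL.
  apply: filterS3 f_cvg v_gt0 phiE => x fx vx px _.
  by rewrite /L (limn_einf_truncated _ (fx j) (vx j)) (px j).1.
Unshelve. all: by end_near.
Qed.

End MultilinearDuality.

(** * Power sums of homogeneous maps *)

Section Scalars.
Context {R : realType}.
Implicit Types k : scalar_kind.

Definition real_scalar k : R -> scalar R k :=
  match k return R -> scalar R k with
  | RealScalars => fun c => c
  | ComplexScalars => fun c => Complex c 0
  end.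

Lemma modulus_ge0 k (a : scalar R k) : 0 <= modulus a.
Proof. by case: k a => [a|[a b]] /=; [exact: normr_ge0|exact: sqrtr_ge0]. Qed.

Lemma modulus0 k : modulus (0 : scalar R k) = 0.
Proof. by case: k => /=; [exact: normr0|exact: ComplexField.Normc.normc0]. Qed.

Lemma modulusM k (a b : scalar R k) : modulus (a * b) = modulus a * modulus b.
Proof.
by case: k a b => a b /=; [exact: normrM|exact: ComplexField.Normc.normcM].
Qed.

Lemma modulus_real_scalar k c : 0 <= c -> modulus (real_scalar k c) = c.
Proof.
case: k => c0 /=; first exact: ger0_norm.
by rewrite expr0n/= addr0 sqrtr_sqr ger0_norm.
Qed.

Lemma nnmeasurable_modulus k (dd : measure_display) (X : measurableType dd)
  (g : X -> scalar R k) : scalar_measurable g -> nnmeasurable (fun x => modulus (g x)).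
Proof.
case: k g => g /=.
  move=> mg; split=> [|x]; last exact: normr_ge0.
  by apply: (measurableT_comp _ mg); exact: normr_measurable.
move=> [mr mi].
rewrite (_ : (fun x => _) =
    (fun x => (complex.Re (g x) ^+ 2 + complex.Im (g x) ^+ 2) `^ (2^-1))).
  apply: nnmeasurable_powR; split.
    by apply: measurable_funD; exact: measurable_funX.
  by move=> x; rewrite addr_ge0// sqr_ge0.
apply/funext => x; rewrite powR12_sqrt; last by rewrite addr_ge0// sqr_ge0.
by case: (g x).
Qed.

End Scalars.

Section PowerSums.
Context {R : realType} {k : scalar_kind} {dd : measure_display}
  {X : measurableType dd}.
Variables (mu : {measure set X -> \bar R}) (Y : quasiNormedSpace R k).
Variables (p : R) (T : Y -> X -> scalar R k).
Hypothesis p_gt0 : 0 < p.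
Hypothesis T_meas : forall f, scalar_measurable (T f).
Hypothesis T_homog : forall (a : scalar R k) (f : Y),
  {ae mu, forall x, T (a *: f) x = a * T f x}.

Lemma qnorm0 : qnorm (0 : Y) = 0.
Proof. by rewrite -(scale0r (0 : Y)) qnormZ modulus0 mul0r. Qed.

Lemma T0_ae : {ae mu, forall x, T 0 x = 0}.
Proof.
by apply: filterS (T_homog 0 0) => x; rewrite scale0r mul0r.
Qed.

Lemma modulus_T_scale c f : 0 <= c ->
  {ae mu, forall x, modulus (T (real_scalar k c *: f) x) = c * modulus (T f x)}.
Proof.
move=> c0; apply: filterS (T_homog (real_scalar k c) f) => x ->.
by rewrite modulusM modulus_real_scalar.
Qed.

Lemma nnmeasurable_T f : nnmeasurable (fun x => modulus (T f x) `^ p).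
Proof. by apply: nnmeasurable_powR; exact: nnmeasurable_modulus (T_meas f). Qed.

(** The almost everywhere equality, rather than equality, makes the set convex
    although the maps are homogeneous only almost everywhere. *)
Definition power_sums : set (X -> R) := [set g | nnmeasurable g /\
  exists s : seq Y, \sum_(f <- s) qnorm f `^ p <= 1 /\
    {ae mu, forall x, g x = \sum_(f <- s) modulus (T f x) `^ p}].

Lemma sum_T_scale c (s : seq Y) : 0 <= c ->
  {ae mu, forall x,
    \sum_(f <- map (fun f => real_scalar k c *: f) s) modulus (T f x) `^ p =
    c `^ p * \sum_(f <- s) modulus (T f x) `^ p}.
Proof.
move=> c0; elim: s => [|f s IH].
  by apply: aeW => x; rewrite !big_nil mulr0.
apply: filterS2 IH (modulus_T_scale f c0) => x IHx fx.
by rewrite map_cons !big_cons IHx fx powRM ?modulus_ge0// mulrDr.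
Qed.

Lemma sum_qnorm_scale c (s : seq Y) : 0 <= c ->
  \sum_(f <- map (fun f => real_scalar k c *: f) s) qnorm f `^ p =
  c `^ p * \sum_(f <- s) qnorm f `^ p.
Proof.
move=> c0; rewrite big_map mulr_sumr; apply: eq_bigr => f _.
by rewrite qnormZ modulus_real_scalar// powRM// qnorm_ge0.
Qed.

Lemma power_sums_nonempty : power_sums !=set0.
Proof.
exists (fun=> 0); split; first exact: nnmeasurable_cst.
by exists [::]; rewrite !big_nil; split => //; apply: aeW => x; rewrite big_nil.
Qed.

(** Rescaling the vectors by [(1 - t)^(1/p)] and [t^(1/p)] and concatenating
    the two lists realises the convex combination. *)
Lemma power_sums_convex g h t : 0 <= t <= 1 -> power_sums g -> power_sums h ->
  power_sums (fun x => (1 - t) * g x + t * h x).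
Proof.
move=> /andP[t0 t1] [g0 [sg [sg1 gE]]] [h0 [sh [sh1 hE]]].
have t1' : 0 <= 1 - t by rewrite subr_ge0.
have rootK c : 0 <= c -> (c `^ p^-1) `^ p = c.
  by move=> c0; rewrite -powRrM mulVf ?gt_eqF// powRr1.
split.
  by apply: nnmeasurable_add; apply: nnmeasurable_mul => //; exact: nnmeasurable_cst.
exists (map (fun f => real_scalar k ((1 - t) `^ p^-1) *: f) sg ++
        map (fun f => real_scalar k (t `^ p^-1) *: f) sh); split.
  rewrite big_cat/= !sum_qnorm_scale ?powR_ge0// !rootK//.
  nra.
apply: filterS (filterI (filterI gE hE) (filterI (sum_T_scale sg (powR_ge0 (1 - t) p^-1))
  (sum_T_scale sh (powR_ge0 t p^-1)))) => x [[gx hx] [sgx shx]].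
by rewrite big_cat/= sgx shx !rootK// gx hx.
Qed.

Lemma normalised_mem c f : 0 <= c -> c * qnorm f <= 1 ->
  power_sums (fun x => c `^ p * modulus (T f x) `^ p).
Proof.
move=> c0 cf; split.
  apply: nnmeasurable_mul; last exact: nnmeasurable_T.
  by apply: nnmeasurable_cst; exact: powR_ge0.
exists [:: real_scalar k c *: f]; split.
  rewrite big_seq1 qnormZ modulus_real_scalar//.
  rewrite [leRHS](_ : 1 = 1 `^ p); last by rewrite powR1.
  apply: ge0_ler_powR; rewrite ?nnegrE ?mulr_ge0 ?qnorm_ge0//.
  exact: ltW.
apply: filterS (modulus_T_scale f c0) => x fx.
by rewrite big_seq1 fx powRM// modulus_ge0.
Qed.

(** The functions [|T f|] are already positive where needed; shrinking [f] to
    norm at most [1] does not affect positivity. *)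
Lemma power_sums_saturate :
  saturates mu [set g | exists f : Y, g = fun x => modulus (T f x)] ->
  saturates mu power_sums.
Proof.
move=> sat E mE Epos.
have [E' [_ [mE' E'E E'pos [f ->] f_gt0]]] := sat E mE Epos.
pose c := (1 + qnorm f)^-1.
have q0 : 0 <= qnorm f by exact: qnorm_ge0.
have c0 : 0 < c by rewrite invr_gt0 ltr_pwDl.
exists E', (fun x => c `^ p * modulus (T f x) `^ p); split => //.
  apply: normalised_mem; first exact: ltW.
  by rewrite mulrC ler_pdivrMr ?ltr_pwDl// mul1r lerDr.
by move=> x /f_gt0 fx; rewrite mulr_gt0// powR_gt0.
Qed.

(** Padding with the zero vector brings lists of different lengths, one for
    each [j], to the common length that the hypothesis of the theorem demands. *)
Lemma sum_nth_padded (F : Y -> R) (s : seq Y) N : (size s <= N)%N -> F 0 = 0 ->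
  \sum_(n < N) F (nth 0 s n) = \sum_(f <- s) F f.
Proof.
move=> sN F0; rewrite -(big_mkord xpredT (fun n => F (nth 0 s n))).
rewrite (@big_cat_nat _ _ _ (size s))//= [X in _ + X]big1_seq ?addr0.
  by rewrite [RHS](big_nth 0).
by move=> n /andP[_]; rewrite mem_index_iota => /andP[sn _]; rewrite nth_default.
Qed.

(** Apply the bound to [f / ||f||]; when [||f|| = 0], the function [T f = T 0]
    vanishes almost everywhere. *)
Lemma power_sums_weight_bound (A : R) (phi : X -> R) : 0 <= A ->
  nnmeasurable phi ->
  (forall g, power_sums g -> (\int[mu]_x (g x * phi x)%:E <= A%:E)%E) ->
  forall f, (\int[mu]_x (modulus (T f x) `^ p * phi x)%:E <= (A * qnorm f `^ p)%:E)%E.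
Proof.
move=> A0 phi0 bound f.
have Tf := nnmeasurable_T f.
have [f0|fN0] := eqVneq (qnorm f) 0.
  rewrite f0 powR0 ?gt_eqF// mulr0.
  have -> : f = 0 by exact: qnorm_eq0.
  have T0 := nnmeasurable_mul (nnmeasurable_T 0) phi0.
  rewrite (@ge0_ae_eq_integral _ _ _ mu setT _ (cst 0%E)) ?integral0//.
  - exact: nnmeasurable_EFin T0.
  - by move=> x _; rewrite lee_fin T0.2.
  by apply: filterS T0_ae => x -> _; rewrite modulus0 powR0 ?gt_eqF// mul0r.
have f_gt0 : 0 < qnorm f by rewrite lt_neqAle eq_sym fN0 qnorm_ge0.
have c0 : 0 <= (qnorm f)^-1 by rewrite invr_ge0 ltW.
have cf : (qnorm f)^-1 * qnorm f <= 1 by rewrite mulVf.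
have := bound _ (normalised_mem c0 cf).
under eq_integral do rewrite -mulrA.
rewrite nnintegralZ ?powR_ge0//; last exact: nnmeasurable_mul.
have -> : (qnorm f)^-1 `^ p = (qnorm f `^ p)^-1.
  by rewrite -powR_inv1 ?ltW// -powRrM mulrC powRrM powR_inv1// powR_ge0.
move=> H; rewrite mulrC EFinM -lee_pdivrMl ?powR_gt0//.
Qed.

End PowerSums.

(** * Factorisation *)

Theorem theorem2p3 (R : realType) (k : scalar_kind)
    (dd : measure_display) (X : measurableType dd)
    (mu : {sigma_finite_measure set X -> \bar R})
    (d : nat) (Y : 'I_d -> quasiNormedSpace R k)
    (p : 'I_d -> R) (hp : forall j, 0 < p j)
    (T : forall j : 'I_d, Y j -> X -> scalar R k)
    (T_meas : forall (j : 'I_d) (f : Y j), scalar_measurable (T j f))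
    (T_homog : forall (j : 'I_d) (a : scalar R k) (f : Y j),
      {ae mu, forall x, T j (a *: f) x = a * T j f x})
    (T_sat : forall j : 'I_d,
      saturates mu [set g | exists f : Y j, g = fun x => modulus (T j f x)])
    (theta : 'I_d -> R) (theta_gt0 : forall j, 0 < theta j)
    (theta_sum : \sum_(j < d) theta j = 1)
    (A : R)
    (hA : forall (N : nat) (f : forall j : 'I_d, 'I_N -> Y j), (1 <= N)%N ->
      (\int[mu]_x (\prod_(j < d)
          (\sum_(n < N) modulus (T j (f j n) x) `^ p j) `^ theta j)%:E
       <= (A * \prod_(j < d)
          (\sum_(n < N) qnorm (f j n) `^ p j) `^ theta j)%:E)%E) :
  exists phi : 'I_d -> X -> R,
    [/\ forall j, measurable_fun [set: X] (phi j),
        forall j x, 0 <= phi j x,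
        {ae mu, forall x, 1 <= \prod_(j < d) phi j x `^ theta j} &
        forall (j : 'I_d) (f : Y j),
          ((\int[mu]_x (modulus (T j f x) `^ p j * phi j x)%:E) `^ (p j)^-1
           <= (A `^ (p j)^-1 * qnorm f)%:E)%E].
Proof.
(* The hypothesis allows [A < 0] only on a null space; replacing [A] by its
   positive part avoids a separate case. *)
pose A' := Num.max A 0.
have A'0 : 0 <= A' by rewrite le_max lexx orbT.
have A'_root j : A' `^ (p j)^-1 <= A `^ (p j)^-1.
  have [A0|A0] := leP 0 A; first by rewrite /A' max_l.
  rewrite /A' (max_r (ltW A0)) powR0; first exact: powR_ge0.
  by rewrite gt_eqF// invr_gt0.
pose G j := power_sums mu (p j) (T j).
have G_bound (g : 'I_d -> X -> R) : (forall j, G j (g j)) ->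
    (\int[mu]_x (gmean theta (g^~ x))%:E <= A'%:E)%E.
  move=> Gg; pose s j := sval (cid (Gg j).2).
  have s_norm j : \sum_(u <- s j) qnorm u `^ p j <= 1 := (svalP (cid (Gg j).2)).1.
  have s_val j : {ae mu, forall x, g j x = \sum_(u <- s j) modulus (T j u x) `^ p j}
    := (svalP (cid (Gg j).2)).2.
  pose N := (\max_j size (s j)).+1.
  have s_size j : (size (s j) <= N)%N by rewrite leqW// leq_bigmax.
  pose f j (n : 'I_N) : Y j := nth 0 (s j) n.
  have sum_nn j : nnmeasurable (fun x => \sum_(n < N) modulus (T j (f j n) x) `^ p j).
    by apply: nnmeasurable_sum => n; exact: nnmeasurable_T (T_meas j) _.
  have -> : (\int[mu]_x (gmean theta (g^~ x))%:E =
      \int[mu]_x (gmean theta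
        (fun j => \sum_(n < N) modulus (T j (f j n) x) `^ p j))%:E)%E.
    have g0 : nnmeasurable (fun x => gmean theta (g^~ x)).
      by apply: nnmeasurable_gmean => j; exact: (Gg j).1.
    have f0 := nnmeasurable_gmean theta sum_nn.
    apply: ge0_ae_eq_integral => //.
    - exact: nnmeasurable_EFin g0.
    - exact: nnmeasurable_EFin f0.
    - by move=> x _; rewrite lee_fin g0.2.
    - by move=> x _; rewrite lee_fin f0.2.
    have : {ae mu, forall x, forall j : 'I_d,
        g j x = \sum_(u <- s j) modulus (T j u x) `^ p j /\ T j 0 x = 0}.
      apply: filter_forall => j; apply: filterI (s_val j) _.
      exact: T0_ae (T_homog j).
    apply: filterS => x gx _; congr (gmean _ _)%:E; apply/funext => j.
    have [-> T0] := gx j.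
    rewrite (sum_nth_padded (F := fun u => modulus (T j u x) `^ p j) (s_size j))//.
    by rewrite T0 modulus0 powR0// gt_eqF.
  apply: le_trans (hA N f _) _ => //.
  rewrite lee_fin; set P := \prod_(_ < _) _.
  have P0 : 0 <= P by apply: prodr_ge0 => j _; exact: powR_ge0.
  have P1 : P <= 1.
    rewrite -[leRHS](gmean_cst theta_gt0 theta_sum ler01).
    apply: le_gmean => // j; first by apply: sumr_ge0 => n _; exact: powR_ge0.
    rewrite (sum_nth_padded (F := fun u => qnorm u `^ p j) (s_size j))//.
    by rewrite qnorm0 powR0// gt_eqF.
  apply: le_trans (_ : A' * P <= _); last by rewrite ler_piMr.
  by apply: ler_wpM2r => //; rewrite le_max lexx.
have [phi [phi0 phi_ge1 phi_int]] := multilinear_duality theta_gt0 theta_sum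
  (fun j => power_sums_nonempty mu (p j) (T j))
  (fun j g => @proj1 _ _)
  (fun j => power_sums_convex (hp j) (T_homog j))
  (fun j => power_sums_saturate (hp j) (T_meas j) (T_homog j) (T_sat j))
  G_bound.
exists phi; split => //; first by move=> j; exact: (phi0 j).1.
  by move=> j x; exact: (phi0 j).2.
move=> j f.
have := power_sums_weight_bound (hp j) (T_meas j) (T_homog j) A'0 (phi0 j)
  (phi_int j) f.
have : (0 <= \int[mu]_x (modulus (T j f x) `^ p j * phi j x)%:E)%E.
  by apply: nnintegral_ge0; apply: nnmeasurable_mul => //; exact: nnmeasurable_T.
case: (\int[mu]_x _)%E => [r| |]//; rewrite !lee_fin => r0 r_le.
have q0 : 0 <= qnorm f by exact: qnorm_ge0.
have pV0 : 0 <= (p j)^-1 by rewrite invr_ge0 ltW.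
apply: (@le_trans _ _ ((A' * qnorm f `^ p j) `^ (p j)^-1)).
  by apply: ge0_ler_powR; rewrite ?nnegrE ?mulr_ge0 ?powR_ge0.
rewrite powRM ?powR_ge0// -powRrM divff ?gt_eqF// powRr1//.
exact: ler_wpM2r.
Qed.
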